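(* There exist a Boolean group $H$ of cardinality $\mathfrak c$ and a group topology on $H$ such that: (1) $H$ is Hausdorff; (2) $H$ has no non-trivial convergent sequences; (3) $H$ is $\mathcal B$-countably compact for every barrier $\mathcal B$ (on any infinite subset of $\omega$); (4) $H^2$ is not countably compact (so $H$ is not $2$-cascade countably compact).
   Context: $\mathfrak c=2^{\aleph_0}$. A Boolean group is a group in which every element $x$ satisfies $x^2=e$. A convergent sequence is non-trivial if it is not eventually constant. A group topology is one making multiplication and inversion continuous. For $a,b\subseteq\omega$, $a\sqsubseteq b$ means $a$ is an initial segment of $b$. A front on an infinite set $M\subseteq\omega$ is a family $\mathcal B\subseteq[M]^{<\omega}$ of finite subsets of $M$ that is a $\sqsubseteq$-antichain and such that every infinite $N\subseteq M$ has an initial segment $s\sqsubseteq N$ with $s\in\mathcal B$. A barrier on $M$ is a front on $M$ which is also a $\subseteq$-antichain. If $\mathcal B$ is a front on $M$ with $\emptyset\notin\mathcal B$ and $n\in M$, put $\mathcal B_{\{n\}}=\{t\setminus\{n\}:\{n\}\sqsubseteq t\in\mathcal B\}$; it is a front on $M\setminus(n+1)$ (a barrier if $\mathcal B$ is). The recursion passing from $\mathcal B$ to the $\mathcal B_{\{n\}}$ is well-founded and ends at fronts containing $\emptyset$ (i.e. $\mathcal B=\{\emptyset\}$). For a free filter $\mathcal F$ on $\omega$ with $M\in\mathcal F$ and a front $\mathcal B$ on $M$, the filter $\mathcal F^{\mathcal B}$ on $\mathcal B$ is defined recursively: if $\emptyset\in\mathcal B$, $\mathcal F^{\mathcal B}=\{\{\emptyset\}\}$;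 otherwise, $\mathcal F^{\mathcal B}$ is the set of all $A\subseteq\mathcal B$ such that $\{n\in M:\{s\in\mathcal B_{\{n\}}:\{n\}\cup s\in A\}\in\mathcal F^{\mathcal B_{\{n\}}}\}\in\mathcal F$. A space $X$ is $\mathcal B$-countably compact (for $\mathcal B$ a front on $M$) if for every $f:\mathcal B\to X$ there is a free ultrafilter $p$ on $\omega$ with $M\in p$ such that $f$ has a $p^{\mathcal B}$-limit point $x\in X$, i.e. $\{s\in\mathcal B:f(s)\in U\}\in p^{\mathcal B}$ for every neighborhood $U$ of $x$. A space is countably compact if every sequence $(x_n:n\in\omega)$ in it has an accumulation point, i.e. a point each of whose neighborhoods contains $x_n$ for infinitely many $n$. $X$ is $2$-cascade countably compact if for every $f:[\omega]^2\to X$ (defined on two-element subsets of $\omega$) there are a free ultrafilter $p$ on $\omega$, a set $A\in p$, points $x_n\in X$ for $n\in A$, and $x\in X$ such that for every $n\in A$, $x_n$ is a $p$-limit of $(f(\{n,m\}):m>n)$, and $x$ is a $p$-limit of $(x_n:n\in A)$; here $y$ is a $p$-limit of $(y_m:m\in D)$, with $D\in p$, if $\{m\in D:y_m\in U\}\in p$ for every neighborhood $U$ of $y$. *)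

(* Defs.v *)
From HB Require Import structures.
From mathcomp Require Import all_boot all_order all_algebra.
From mathcomp Require Import finmap.
From mathcomp Require Import boolp classical_sets functions cardinality filter.
From mathcomp Require Import topology tvs.

Set Implicit Arguments.
Unset Strict Implicit.
Unset Printing Implicit Defensive.

Local Open Scope classical_set_scope.

(* a is an initial segment of b *)
Definition iseg (a b : set nat) : Prop :=
  a `<=` b /\ forall m n, b m -> a n -> (m <= n)%N -> a m.

Record is_front (M : set nat) (B : set {fset nat}) : Prop := IsFront {
  front_infinite : infinite_set M;
  front_sub : forall s, B s -> [set` s] `<=` M;
  front_antichain : forall s t, B s -> B t -> iseg [set` s] [set` t] -> s = t;
  front_iseg : forall N, infinite_set N -> N `<=` M ->
    exists2 s, B s & iseg [set` s] N
}.

Definition is_barrier (M : set nat) (B : set {fset nat}) : Prop :=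
  is_front M B /\ forall s t, B s -> B t -> (s `<=` t)%fset -> s = t.

(* The pair (M \ (n+1), B_{n}) obtained from (M, B). *)
Definition tail (M : set nat) (n : nat) : set nat := M `&` [set m | (n < m)%N].

Definition fsection (B : set {fset nat}) (n : nat) : set {fset nat} :=
  [set (t `\ n)%fset | t in [set t | B t /\ iseg [set n] [set` t]]].

Definition child (X : set nat * set {fset nat}) (n : nat) :=
  (tail X.1 n, fsection X.2 n).

Definition child_rel (Y X : set nat * set {fset nat}) : Prop :=
  ~ X.2 fset0 /\ exists2 n, X.1 n & Y = child X n.

Lemma child_relP (X : set nat * set {fset nat}) (n : nat) :
  ~ X.2 fset0 -> X.1 n -> child_rel (child X n) X.
Proof. by move=> X0 Xn; split=> //; exists n. Qed.

Lemma front_acc (M : set nat) (B : set {fset nat}) :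
  is_front M B -> Acc child_rel (M, B).
Proof.
move=> frB; apply: contrapT => nacc.
have /choice[g gP] (X : set nat * set {fset nat}) : exists n,
    ~ Acc child_rel X -> [/\ ~ X.2 fset0, X.1 n & ~ Acc child_rel (child X n)].
  have [aX|naX] := pselect (Acc child_rel X); first by exists 0%N.
  apply: contrapT => /forallNP nX; apply: naX; constructor=> Y [X0 [n Xn ->]].
  by apply: contrapT => nY; apply: (nX n).
pose Z k := iter k (fun X => child X (g X)) (M, B).
have nZ k : ~ Acc child_rel (Z k) by elim: k => //= k /gP[].
pose h k := g (Z k).
have Zh k : (Z k).1 (h k) by have [] := gP _ (nZ k).
have Z0 k : ~ (Z k).2 fset0 by have [] := gP _ (nZ k).
have ZM k : (Z k).1 `<=` M by elim: k => //= k IH n [/IH].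
have hS k : (h k < h k.+1)%N by have [] := Zh k.+1.
have hlt : {homo h : i j / (i < j)%N} by apply: homo_ltn => // ? ? ?; apply: ltn_trans.
have hle : {homo h : i j / (i <= j)%N}.
  by move=> i j; rewrite leq_eqVlt => /orP[/eqP->//|/hlt/ltnW].
have hinj : injective h.
  move=> i j hij; case: (ltngtP i j) => // /hlt; by rewrite hij ltnn.
pose N k := [set h j | j in [set j | (k <= j)%N]].
have Ninf : infinite_set (N 0%N).
  rewrite (eq_finite_set (inj_card_eq _)); first by apply: sub_infinite_set infinite_nat.
  by move=> i j _ _ /hinj.
have [|s Bs sN] := front_iseg frB Ninf.
  by move=> _ [j _ <-]; apply/(ZM j).
suff key c : forall k t, #|` t| = c -> (Z k).2 t -> iseg [set` t] (N k) -> False.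
  exact: (key _ 0%N s erefl).
elim: c => [|c IH] k t ct Zt [tN tseg].
  by move/cardfs0_eq: ct Zt => -> /Z0.
have hkt : h k \in t.
  have [x xt] : exists x, x \in t by apply/fset0Pn; rewrite -cardfs_gt0 ct.
  have [j kj hj] := tN _ xt.
  by apply: (tseg _ x) => //; [exists k => /= | rewrite -hj hle].
apply: (IH k.+1 (t `\ h k)%fset).
- by move: ct; rewrite (cardfsD1 (h k)) hkt add1n => -[].
- exists t => //; split=> //; split=> [_ -> //|m n /= mt -> mh].
  by have [j kj hj] := tN _ mt; apply/eqP; rewrite eqn_leq mh -hj hle.
split=> [x /=|m n /= [j kj <-]].
  rewrite !inE => /andP[xh xt]; have [j kj hj] := tN _ xt.
  exists j => //=; rewrite ltn_neqAle kj andbT; apply/eqP => E.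
  by move: xh; rewrite -hj E eqxx.
rewrite !inE => /andP[_ nt] hn; apply/andP; split.
  by rewrite gtn_eqF// hlt.
by apply: (tseg _ n) => //; exists j => //=; apply: ltnW.
Qed.

(* The filter F^B, by recursion on the (well-founded) passage from B to B_{n} *)
Fixpoint fpow_rec (F : set_system nat) (X : set nat * set {fset nat})
    (a : Acc child_rel X) {struct a} : set_system {fset nat} :=
  match pselect (X.2 fset0) with
  | left _ => [set [set fset0]]
  | right X0 => [set A | A `<=` X.2 /\
      F [set n | exists Xn : X.1 n,
           fpow_rec F (Acc_inv a (child_relP X0 Xn))
             [set s | fsection X.2 n s /\ A (n |` s)%fset]]]
  end.

Definition fpow (F : set_system nat) (M : set nat) (B : set {fset nat})
    (frB : is_front M B) : set_system {fset nat} :=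
  fpow_rec F (front_acc frB).

Lemma front_section (M : set nat) (B : set {fset nat}) (n : nat) :
  is_front M B -> ~ B fset0 -> M n -> is_front (tail M n) (fsection B n).
Proof.
move=> frB B0 Mn.
have tlinf N : infinite_set N -> infinite_set (tail N n).
  move=> Ninf tfin; apply: Ninf.
  apply: (@sub_finite_set _ _ (tail N n `|` `I_n.+1)).
    by move=> x Nx; have [/= xn|nx] := leqP x n; [right|left].
  by rewrite finite_setU; split => //; exact: finite_II.
have secP s : fsection B n s ->
    [/\ B (n |` s)%fset, n \notin s & forall x, x \in s -> (n < x)%N].
  move=> [t [Bt [nt tn]] <-]; have {}nt : n \in t by exact: (nt n).
  split; first by rewrite fsetD1K.
    by rewrite !inE eqxx.
  move=> x; rewrite !inE => /andP[xn xt]; rewrite ltnNge; apply/negP => xln.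
  by have /= xE := tn _ n xt erefl xln; rewrite xE eqxx in xn.
split.
- by apply: tlinf; exact: front_infinite frB.
- move=> s /secP[Bs ns nlt] x /= xs; split; last exact: nlt.
  by apply: (front_sub frB Bs); rewrite /= !inE xs orbT.
- move=> s t /secP[Bs ns slt] /secP[Bt nt tlt] [st seg].
  suff E : (n |` s = n |` t)%fset by rewrite -(fsetU1K ns) -(fsetU1K nt) E.
  apply: (front_antichain frB Bs Bt); split=> [x /=|x y /=].
    by rewrite !inE => /orP[->//|/st /= ->]; rewrite orbT.
  rewrite !inE => /orP[->//|xt] /orP[/eqP->|ys] xy.
    by move: (tlt _ xt); rewrite ltnNge xy.
  by apply/orP; right; exact: (seg x y).
move=> N Ninf NM.
have [||s Bs [sN sseg]] := front_iseg frB (N := n |` N).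
- by apply: sub_infinite_set Ninf => x; right.
- by move=> x [->//|/NM[]].
have gN x : N x -> (n < x)%N by move=> /NM[].
have ns : n \in s.
  have [x xs] : exists x, x \in s by apply/fset0Pn; apply: contra_not_neq B0 => <-.
  apply: (sseg n x) => //; first by left.
  by have [->//|/gN/ltnW] := sN _ xs.
exists (s `\ n)%fset.
  exists s => //; split=> //; split=> [_ ->//|m k /= ms -> mn].
  by have [//|/gN] := sN _ ms; rewrite ltnNge mn.
split=> [x /=|x y Nx /=].
  rewrite !inE => /andP[/eqP xn xs].
  by have [/xn|] := sN _ xs.
rewrite !inE => /andP[_ ys] xy; apply/andP; split.
  by rewrite gtn_eqF// gN.
by apply: (sseg x y) => //; right.
Qed.

Lemma fpow_rec_irr (F : set_system nat) (X : set nat * set {fset nat})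
  (a b : Acc child_rel X) : fpow_rec F a = fpow_rec F b.
Proof. by rewrite (Prop_irrelevance a b). Qed.

Lemma fpow0 (F : set_system nat) (M : set nat) (B : set {fset nat})
  (frB : is_front M B) : B fset0 -> fpow F frB = [set [set fset0]].
Proof.
by rewrite /fpow; case: (front_acc frB) => a B0 /=; case: pselect.
Qed.

Lemma fpowS (F : set_system nat) (M : set nat) (B : set {fset nat})
    (frB : is_front M B) (B0 : ~ B fset0) :
  fpow F frB = [set A | A `<=` B /\
    F [set n | exists Mn : M n, fpow F (front_section frB B0 Mn)
                 [set s | fsection B n s /\ A (n |` s)%fset]]].
Proof.
rewrite {1}/fpow; case: (front_acc frB) => a /=; case: pselect => // B0'.
have E n (Mn : M n) : fpow_rec F (a _ (child_relP (X := (M, B)) B0' Mn)) =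
    fpow F (front_section frB B0 Mn) by exact: fpow_rec_irr.
apply/seteqP; split=> A [AB FA]; split=> //; move: FA;
  congr (F _); apply/seteqP; split=> n [Mn fA]; exists Mn;
  by [rewrite -E | rewrite E].
Qed.

Definition free_ultrafilter (p : set_system nat) : Prop :=
  UltraFilter p /\ \bigcap_(A in p) A = set0.

(* Functions on B are given by total functions on {fset nat}, whose values
   outside B are irrelevant. *)
Definition front_countably_compact (X : topologicalType)
    (M : set nat) (B : set {fset nat}) (frB : is_front M B) : Prop :=
  forall f : {fset nat} -> X, exists p : set_system nat,
    [/\ free_ultrafilter p, p M & exists x : X, forall U, nbhs x U ->
        fpow p frB [set s | B s /\ U (f s)]].

Definition countably_compact (X : topologicalType) : Prop :=
  forall u : nat -> X, exists x : X, forall U, nbhs x U ->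
    infinite_set [set n | U (u n)].

Definition plimit (X : topologicalType) (p : set_system nat) (D : set nat)
    (y : nat -> X) (x : X) : Prop :=
  p D /\ forall U, nbhs x U -> p [set m | D m /\ U (y m)].

Definition two_cascade_countably_compact (X : topologicalType) : Prop :=
  forall f : {fset nat} -> X, exists p : set_system nat,
    free_ultrafilter p /\ exists (A : set nat) (y : nat -> X) (x : X),
      [/\ p A,
          forall n, A n ->
            plimit p [set m | (n < m)%N] (fun m => f [fset n; m]%fset) (y n)
        & plimit p A y x].

Definition no_nontrivial_convergent_sequence (X : topologicalType) : Prop :=
  forall (u : nat -> X) (x : X), u @ \oo --> x ->
    exists c : X, \forall n \near \oo, u n = c.

(* Main.v *)
Require Import Defs.
From HB Require Import structures.
From mathcomp Require Import all_boot all_order all_algebra.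
From mathcomp Require Import finmap.
From mathcomp Require Import boolp classical_sets functions cardinality filter.
From mathcomp Require Import topology tvs.
From mathcomp Require Import wochoice zify.

(** Let C be the Boolean group of functions on the Cantor set with values in the
two-element group, with pointwise convergence. The group H is the subgroup of C
generated by the coordinate functions and by points c_k, where k runs through a
well-ordered set K. An index k lists a front B and a function f on B whose values
are sums of coordinates and of earlier points c_b, each such function being listed
cofinally often, and c_k is the limit of f along p_k^B for a free ultrafilter p_k.
Such limits exist because pointwise limits of bits along an ultrafilter exist, so
H is front countably compact for any choice of the ultrafilters; it is Hausdorff
as a space of functions, and it has the size of the continuum because K does. The
ultrafilters are chosen so that the other two properties hold.

Convergent sequences. Limits of independent sequences along suitable ultrafilters
can be prescribed at will. Divide the natural numbers into consecutive, quickly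
growing blocks. Each branch g of the binary tree has a generic ultrafilter that
contains the union of the blocks on the branch, and the complement of every set
that meets each such block in few points. Countably many independent sequences,
attached to distinct branches, have almost disjoint sets of blocks, so that the
blocks can be treated one by one; in each block, only as many terms are discarded
as there are vectors involved in the earlier ones, and the rest is independent of
them ([delete_indices]). Therefore, if each sequence is assigned a limit, arbitrary
and purely formal, then some homomorphism sends each sequence, eventually along its
ultrafilter, to the value at its limit, without killing a given nonzero vector
([core]). If the p_k come from distinct branches, then a convergent sequence of H
that is not eventually constant would take both values 0 and 1 infinitely often at
some point of the Cantor set: two further branches are used to force this
([gset_convergent]).

Functions on fronts. A function on a front need not be independent on any large
set, and iterated limits with the same ultrafilter interfere: e_n + e'_m has the
same limit as e_n + e'_n. This is resolved formally, by a fusion along the front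
([front_limit]): the sequence of limits met at a node either is, on an infinite
set, a combination of sequences met before, up to a constant, or it is independent
of them and receives a new formal limit. The outcome is a countable independent
system of sequences, on a set that is thinned once more by [thin_system], such
that the limit of the function is a combination of earlier generators and of
formal limits. The formal limits live in a free Boolean group; they are not put in
H, since this could create common limits as in the next paragraph.

The square. Put e_n and e'_n for the even and the odd coordinates. An accumulation
point of the sequence (e_n, e'_n) in the square of H would give a free ultrafilter
q whose limits of e_n and of e'_n are both in H. At the first index k after which
this happens, c_k would be determined by two earlier elements of H ([bad_uniq]).
But c_k takes different values for different branches, unless it is an earlier
element anyhow ([limits_distinct]), and the pairs of earlier elements are too few
to exclude all branches. So the choice of p_k can prevent this
([ultrafilter_recursion], [no_common_limit]). For a cascade over e_n + e'_m, the
intermediate limits put the limit of e'_n in H and the final one that of e_n.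

The set K consists of finite structures, that is pairs of a number and a finite
sequence, over an initial segment J of a well-order of the Cantor set; J is as
short as it can be for such structures to reach the size of the continuum
([index_type]). Then finite structures over a proper initial segment of K, like
pairs of earlier elements of H, do not reach it, and the diagonal argument of
Konig shows that countable subsets of K are bounded. *)

Set Implicit Arguments.
Unset Strict Implicit.
Unset Printing Implicit Defensive.
Import GRing.Theory.
Local Open Scope classical_set_scope.
Local Open Scope ring_scope.

(** * Free ultrafilters and their powers along fronts *)

Lemma countable_enum (T : Type) (D : set T) : countable D ->
  exists u : nat -> option T, (forall x, D x <-> exists l, u l = Some x) /\
    forall l l' x, u l = Some x -> u l' = Some x -> l = l'.
Proof.
move=> /countable_injP[rk rkinj].
have /choice[u uP] (l : nat) : exists o : option T, forall x, o = Some x <-> D x /\ rk x = l.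
  have [[x [Dx xl]]|nx] := pselect (exists x, D x /\ rk x = l).
    exists (Some x) => y; split=> [[<-]//|[Dy yl]]; congr Some.
    by apply: rkinj; rewrite ?inE// xl yl.
  by exists None => y; split=> // yP; case: nx; exists y.
exists u; split=> [x|l l' x /uP[_ <-] /uP[_ <-]//].
by split=> [Dx|[l /uP[]//]]; exists (rk x); exact/uP.
Qed.

Section FreeUltrafilters.
Variable p : set_system nat.
Hypothesis pfree : free_ultrafilter p.

Lemma fu_filter : ProperFilter p.
Proof. by case: pfree => -[]. Qed.

Lemma fuT : p setT.
Proof. by have [] := fu_filter => _ []. Qed.

Lemma fuS A B : A `<=` B -> p A -> p B.
Proof. by have [_ []] := fu_filter => _ _; apply. Qed.

Lemma fuI A B : p A -> p B -> p (A `&` B).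
Proof. by have [_ []] := fu_filter => _ + _; apply. Qed.

Lemma fu_ex A : p A -> exists x, A x.
Proof. by have fp := fu_filter; move=> /(@filter_ex _ p fp). Qed.

Lemma fu_or A : p A \/ p (~` A).
Proof. by case: pfree => up _; exact: in_ultra_setVsetC. Qed.

Lemma fu_cofinite A : finite_set A -> p (~` A).
Proof.
move=> finA; case: (fu_or A) => // pA; exfalso.
have sep x : exists2 D, p D & ~ D x.
  apply: contrapT => nD; have [_ p0] := pfree.
  suff : (\bigcap_(A in p) A) x by rewrite p0.
  by move=> D pD; apply: contrapT => nDx; apply: nD; exists D.
have [s sA] : exists s : seq nat, A = [set` s].
  by move/finite_seqP: finA.
have : p (~` [set` s]).
  elim: s {sA} => [|x s IH].
    by apply: fuS fuT => y _ /=; rewrite in_nil.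
  have [D pD nDx] := sep x; apply: fuS (fuI IH pD) => y [/= ys Dy].
  rewrite in_cons => /orP[/eqP yx|//]; by rewrite yx in Dy.
rewrite -sA => pnA; have [x [Ax nAx]] := fu_ex (fuI pA pnA).
by [].
Qed.

Lemma fu_gt n : p [set m | (n < m)%N].
Proof.
apply: fuS (fu_cofinite (finite_II n.+1)) => m /= h.
by rewrite ltnNge; apply/negP => mn; apply: h.
Qed.

End FreeUltrafilters.

Lemma free_ultrafilter_cofinite (p : set_system nat) :
  UltraFilter p -> (forall n, p [set m | (n <= m)%N]) -> free_ultrafilter p.
Proof.
move=> up pn; split=> //; apply/seteqP; split=> // x.
by move=> /(_ _ (pn x.+1)) /=; rewrite ltnn.
Qed.

Lemma free_ultrafilter_push (p : set_system nat) (nu : nat -> nat) :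
  free_ultrafilter p -> (forall a, (a <= nu a)%N) ->
  free_ultrafilter [set A | p (nu @^-1` A)].
Proof.
move=> pf nu_ge; apply: free_ultrafilter_cofinite; last first.
  move=> n; apply: (fuS pf _ (fu_gt pf n)) => a /= /ltnW na; exact: leq_trans (nu_ge a).
have fp := fu_filter pf.
split=> [|G GF sub]; first exact: fmap_proper_filter.
apply/seteqP; split=> // A GA; case: (fu_or pf (nu @^-1` A)) => // pA.
have /filter_ex[x []//] : G (A `&` ~` A) by apply: filterI => //; exact: sub.
Qed.

(** Members of [F] are infinite, so they meet all cofinite sets and the filter
generated by both is still proper. *)
Lemma free_ultrafilter_exists (F : set_system nat) :
  Filter F -> (forall A, F A -> infinite_set A) ->
  exists2 p, free_ultrafilter p & F `<=` p.
Proof.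
move=> FF Finf.
pose G : set_system nat := [set A | exists2 B, F B & exists n, B `&` [set m | (n <= m)%N] `<=` A].
have GF : ProperFilter G.
  apply: Build_ProperFilter_ex.
    move=> A [B FB [n BA]]; have : infinite_set B by apply: Finf.
    move=> Binf; apply: contrapT => nA; apply: Binf.
    apply: (@sub_finite_set _ _ `I_n); last exact: finite_II.
    move=> x Bx /=; rewrite ltnNge; apply/negP => nx; apply: nA; exists x.
    exact: BA.
  split.
  - by exists setT; [exact: filterT|exists 0%N].
  - move=> A A' [B FB [n BA]] [B' FB' [n' BA']].
    exists (B `&` B'); first exact: filterI.
    exists (maxn n n') => x [[Bx B'x] /=]; rewrite geq_max => /andP[nx n'x].
    by split; [exact: BA|exact: BA'].
  - by move=> A A' AA' [B FB [n BA]]; exists B => //; exists n => x /BA/AA'.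
have [p [up Gp]] := @ultraFilterLemma _ G GF.
exists p; last by move=> A FA; apply: Gp; exists A => //; exists 0%N => x [].
apply: free_ultrafilter_cofinite => n; apply: Gp.
by exists setT; [exact: filterT|exists n => x []].
Qed.

(** The recursion that defines the powers of a filter, as an induction principle
free of accessibility proofs. *)
Lemma front_ind (P : forall M B, is_front M B -> Prop) :
  (forall M B fr, B fset0 -> P M B fr) ->
  (forall M B fr (B0 : ~ B fset0),
     (forall n (Mn : M n), P _ _ (front_section fr B0 Mn)) -> P M B fr) ->
  forall M B fr, P M B fr.
Proof.
move=> P0 PS M B fr; have acc := front_acc fr.
move: (M, B) acc fr => X acc fr; pose Q (X : set nat * set {fset nat}) :=
  forall fr : is_front X.1 X.2, P X.1 X.2 fr.
suff : forall X, Acc child_rel X -> Q X by move=> /(_ _ (front_acc fr)) /(_ fr).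
move=> {M B fr acc} Y; elim => {X}Y _ IH fr.
have [B0|B0] := pselect (Y.2 fset0); first exact: P0.
by apply: (PS _ _ _ B0) => n Mn; apply: (IH _ (child_relP B0 Mn)).
Qed.

(** Truth along the power [p^B], for a predicate defined on all finite sets: in
this form a section of the front is reached by precomposition with the insertion
of its first element, see [flimS]. *)
Definition flim (p : set_system nat) M B (fr : is_front M B) (A : {fset nat} -> Prop) :=
  fpow p fr [set s | B s /\ A s].

Lemma flim0 p M B (fr : is_front M B) A : B fset0 -> flim p fr A <-> A fset0.
Proof.
move=> B0; rewrite /flim fpow0//; split=> [E|A0] /=.
  have : [set s | B s /\ A s] fset0 by rewrite E.
  by case.
apply/seteqP; split=> [s [Bs _] /=|s /= ->//]; apply/esym.
by apply: (front_antichain fr B0 Bs); split=> [x|x y _] /=; rewrite inE.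
Qed.

Lemma fsectionP M B (fr : is_front M B) n s : fsection B n s -> B (n |` s)%fset.
Proof.
move=> [t [Bt [nt _]] <-]; have {}nt : n \in t by exact: (nt n).
by rewrite fsetD1K.
Qed.

Lemma flimS p M B (fr : is_front M B) (B0 : ~ B fset0) A :
  flim p fr A <-> p [set n | exists Mn : M n,
      flim p (front_section fr B0 Mn) (fun s => A (n |` s)%fset)].
Proof.
rewrite /flim (fpowS _ _ B0) /=.
have E n : [set s | fsection B n s /\ (B (n |` s)%fset /\ A (n |` s)%fset)] =
           [set s | fsection B n s /\ A (n |` s)%fset].
  apply/seteqP; split=> s [Bs]; first by move=> [].
  by move=> As; split => //; split => //; exact: (fsectionP fr).
have -> : [set n | exists Mn : M n, flim p (front_section fr B0 Mn)
      (fun s => A (n |` s)%fset)] = [set n | exists Mn : M n,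
    fpow p (front_section fr B0 Mn)
      [set s | fsection B n s /\ (B (n |` s)%fset /\ A (n |` s)%fset)]].
  by apply/seteqP; split=> n [Mn] h; exists Mn; move: h; rewrite E.
by split=> [[_]|h] //; split => // s [].
Qed.

Lemma tail_free p M n : free_ultrafilter p -> p M -> p (tail M n).
Proof. by move=> pf pM; apply: fuI => //; exact: fu_gt. Qed.

Section FlimTheory.
Variable p : set_system nat.
Hypothesis pf : free_ultrafilter p.

Lemma flim_mono M B (fr : is_front M B) (A A' : {fset nat} -> Prop) :
  (forall s, B s -> A s -> A' s) -> flim p fr A -> flim p fr A'.
Proof.
move: M B fr A A'; apply: front_ind => [M B fr B0 A A' AA'|M B fr B0 IH A A' AA'].
  by rewrite !flim0//; exact: (AA' _ B0).
rewrite !(flimS _ _ B0); apply: fuS => // n [Mn h]; exists Mn; move: h.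
by apply: IH => s /(fsectionP fr); exact: AA'.
Qed.

Lemma flimT M B (fr : is_front M B) (A : {fset nat} -> Prop) : p M ->
  (forall s, B s -> A s) -> flim p fr A.
Proof.
move: M B fr A; apply: front_ind => [M B fr B0 A _ h|M B fr B0 IH A pM h].
  by rewrite flim0//; exact: (h _ B0).
rewrite (flimS _ _ B0); apply: (fuS pf _ pM) => n Mn; exists Mn.
apply: IH; first exact: (tail_free n pf pM).
by move=> s /(fsectionP fr); exact: h.
Qed.

Lemma flimI M B (fr : is_front M B) (A A' : {fset nat} -> Prop) :
  flim p fr A -> flim p fr A' -> flim p fr (fun s => A s /\ A' s).
Proof.
move: M B fr A A'; apply: front_ind => [M B fr B0 A A'|M B fr B0 IH A A'].
  by rewrite !flim0.
rewrite !(flimS _ _ B0) => pA pA'; apply: fuS (fuI pf pA pA') => // n.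
move=> [[Mn h] [Mn' h']]; exists Mn; apply: IH => //.
by rewrite (Prop_irrelevance Mn Mn').
Qed.

Lemma flim_or M B (fr : is_front M B) (A : {fset nat} -> Prop) : p M ->
  flim p fr A \/ flim p fr (fun s => ~ A s).
Proof.
move: M B fr A; apply: front_ind => [M B fr B0 A _|M B fr B0 IH A pM].
  by rewrite !flim0//; exact: EM.
rewrite !(flimS _ _ B0).
set D := (X in p X \/ _); have [|nD] := fu_or pf D; [by left|right].
apply: fuS (fuI pf pM nD) => // n [Mn nDn]; exists Mn.
have [h|//] := IH n Mn (fun s => A (n |` s)%fset) (tail_free n pf pM).
by case: nDn; exists Mn.
Qed.

Lemma flim_ex M B (fr : is_front M B) (A : {fset nat} -> Prop) :
  flim p fr A -> exists2 s, B s & A s.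
Proof.
move: M B fr A; apply: front_ind => [M B fr B0 A|M B fr B0 IH A].
  by rewrite flim0// => A0; exists fset0.
rewrite (flimS _ _ B0) => /(fu_ex pf)[n [Mn /IH[s Bs As]]].
by exists (n |` s)%fset => //; exact: (fsectionP fr).
Qed.

Lemma flim_bool M B (fr : is_front M B) (v : {fset nat} -> bool) : p M ->
  exists b, flim p fr (fun s => v s = b).
Proof.
move=> pM; have [h|h] := flim_or fr (fun s => v s = true) pM; first by exists true.
by exists false; apply: flim_mono h => s _; case: (v s).
Qed.

Lemma flim_uniq M B (fr : is_front M B) (T : Type) (v : {fset nat} -> T) a b :
  flim p fr (fun s => v s = a) -> flim p fr (fun s => v s = b) -> a = b.
Proof. by move=> ha hb; have [s _ [<-]] := flim_ex (flimI ha hb). Qed.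

End FlimTheory.

(** * Formal limits of functions on fronts *)

Definition bhom (V : zmodType) (psi : V -> bool) :=
  forall x y, psi (x + y) = psi x (+) psi y.

Section BooleanHom.
Variables (V : zmodType) (psi : V -> bool).
Hypothesis psiD : bhom psi.

Lemma bhom0 : psi 0 = false.
Proof. by have := psiD 0 0; rewrite addr0 addbb. Qed.

Lemma bhom_sum (I : Type) (s : seq I) (P : pred I) (F : I -> V) :
  psi (\sum_(i <- s | P i) F i) = \big[addb/false]_(i <- s | P i) psi (F i).
Proof. by apply: (big_morph psi psiD bhom0). Qed.
End BooleanHom.

(** A node [w] of the tree of initial segments of the members of a front is given by
the increasing sequence of its elements. *)
Fixpoint front_at (X : set nat * set {fset nat}) (w : seq nat) :=
  if w is n :: w' then front_at (child X n) w' else X.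

Fixpoint shift_at (T : Type) (f : {fset nat} -> T) (w : seq nat) : {fset nat} -> T :=
  if w is n :: w' then shift_at (fun s => f (n |` s)%fset) w' else f.

Section FrontLimit.
Variable V : zmodType.
Hypothesis V2 : forall x : V, x + x = 0.

(** A sequence with the element that is to be its limit. The pair is respected by
a homomorphism, along an ultrafilter, if eventually the sequence takes the value
of the limit. *)
Definition spair := ((nat -> V) * V)%type.

(** Finite changes of [N] do not matter, so that this notion survives fusions. *)
Definition almost_indep (S : set spair) (N : set nat) :=
  forall S0 : {fset spair}, S0 != fset0 -> [set` S0] `<=` S ->
  forall v, finite_set [set n | N n /\ \sum_(x <- S0) x.1 n = v].

Definition constraints (p : set_system nat) (psi : V -> bool) (S : set spair) :=
  forall x, S x -> p [set n | psi (x.1 n) = psi x.2].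

Definition nodelims p (psi : V -> bool) M B (f : {fset nat} -> V) (z : seq nat -> V) :=
  forall w (fr : is_front (front_at (M, B) w).1 (front_at (M, B) w).2),
    flim p fr (fun s => psi (shift_at f w s) = psi (z w)).

Definition subgrp (G : V -> Prop) := G 0 /\ forall a b, G a -> G b -> G (a + b).

Definition spairs_in (G : V -> Prop) (S : set spair) :=
  forall x, S x -> (forall n, G (x.1 n)) /\ G x.2.

Definition good_system M (st : set nat * set spair) :=
  [/\ infinite_set st.1, st.1 `<=` M, countable st.2 & almost_indep st.2 st.1].

(** The element [y] and the enlarged system describe the limit of [f]. The first
clause is used for the homomorphisms built from the system, which are only known to
respect it. The second one is used for a given point of the Cantor set, where the
values of the formal limits [z w] have to be computed first. The third one says
which elements may occur in [y]. *)
Definition front_limit_spec M B (fr : is_front M B) f z (st st' : set nat * set spair) y :=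
  [/\ good_system M st', st'.1 `<=` st.1 & st.2 `<=` st'.2] /\
  [/\ forall p psi, free_ultrafilter p -> bhom psi -> p st'.1 ->
        constraints p psi st'.2 -> flim p fr (fun s => psi (f s) = psi y),
      forall p psi, free_ultrafilter p -> bhom psi -> p st'.1 ->
        nodelims p psi M B f z -> constraints p psi st.2 -> constraints p psi st'.2
    & forall G, subgrp G -> (forall s, B s -> G (f s)) -> (forall w, G (z w)) ->
        spairs_in G st.2 -> G y /\ spairs_in G st'.2].

Lemma almost_indep_ext S S' N N' : almost_indep S N -> S' `<=` S ->
  finite_set (N' `\` N) -> almost_indep S' N'.
Proof.
move=> ind SS fin S0 S0n S0S v.
apply: (@sub_finite_set _ _ ((N' `\` N) `|` [set n | N n /\ \sum_(x <- S0) x.1 n = v])).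
  by move=> n [N'n e]; have [Nn|nNn] := pselect (N n); [right|left].
rewrite finite_setU; split => //; apply: ind => //; exact: subset_trans SS.
Qed.

Lemma sumr_uniq_add (T : choiceType) (x : T) (S : {fset T}) (F : T -> V) : x \in S ->
  \sum_(i <- S) F i = F x + \sum_(i <- (S `\ x)%fset) F i.
Proof. by move=> xS; rewrite (big_fsetD1 x). Qed.

(** The root step of the fusion: a sequence [Y] is either a finite combination of
earlier null sequences, up to a constant, along an infinite set, or it may be
added to the system with a limit [z0] of its own. *)
Lemma add_sequence M N S (Y : nat -> V) (z0 : V) : good_system M (N, S) ->
  exists N' S' y,
  [/\ good_system M (N', S'), N' `<=` N & S `<=` S'] /\
  [/\ forall p psi, free_ultrafilter p -> bhom psi -> p N' ->
        constraints p psi S' -> p [set n | psi (Y n) = psi y],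
      forall p psi, free_ultrafilter p -> bhom psi -> p N' ->
        p [set n | psi (Y n) = psi z0] -> constraints p psi S -> constraints p psi S'
    & forall G, subgrp G -> (forall n, G (Y n)) -> G z0 ->
        spairs_in G S -> G y /\ spairs_in G S'].
Proof.
move=> [/= Ninf NM Sc Sind].
have [[S0 [v [S0S inf]]]|nodep] := pselect (exists (S0 : {fset spair}) v, [set` S0] `<=` S /\
    infinite_set [set n | N n /\ Y n + \sum_(x <- S0) x.1 n = v]).
  exists [set n | N n /\ Y n + \sum_(x <- S0) x.1 n = v], S, (v + \sum_(x <- S0) x.2).
  split; first split=> //; first split=> //=.
  - by move=> n [/NM].
  - apply: almost_indep_ext Sind _ _ => //; apply: sub_finite_set (finite_set0 _).
    by move=> n [[]].
  - by move=> n [].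
  split=> // [p psi pf hpsi pN con|G [G0 GD] GY Gz0 GS].
    have : p [set n | forall x, x \in S0 -> psi (x.1 n) = psi x.2].
      suff H : forall (s : seq spair), {subset s <= S0} ->
          p [set n | forall x, x \in s -> psi (x.1 n) = psi x.2] by apply: H.
      elim=> [_|x s IH sS]; first by apply: fuS (fuT pf).
      have pS : p [set n | psi (x.1 n) = psi x.2].
        by apply: con; apply: S0S; apply: sS; rewrite mem_head.
      have := IH (fun y ys => sS y (mem_behead (s := x :: s) ys)).
      move=> /(fuI pf pS); apply: fuS => // n [/= xn sn] y.
      by rewrite inE => /orP[/eqP->//|]; exact: sn.
    move=> /(fuI pf pN); apply: fuS => // n [[Nn e]] /= cn.
    have -> : Y n = v + \sum_(x <- S0) x.1 n by rewrite -e -addrA V2 addr0.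
    rewrite !hpsi !(bhom_sum hpsi); congr (_ (+) _).
    by rewrite big_seq [RHS]big_seq; apply: eq_bigr.
  split=> //; have GS0 (F : spair -> V) : (forall x, S x -> G (F x)) -> G (\sum_(x <- S0) F x).
    move=> GF; rewrite big_seq; elim/big_ind: _ => // x xS.
    exact/GF/S0S.
  have [n [Nn <-]] := infinite_setN0 inf.
  apply: (GD); first apply: (GD) => //; apply: GS0 => x /GS[]//.
exists N, (S `|` [set (Y, z0)]), z0.
have nS : ~ S (Y, z0).
  move=> SY; apply: nodep; exists [fset (Y, z0)]%fset, 0; split.
    by move=> x /=; rewrite inE => /eqP->.
  rewrite (_ : [set n | _] = N)//; apply/seteqP; split=> [n []//|n Nn] /=.
  by split=> //; rewrite big_seq_fset1 V2.
split; first split=> //; first split=> //=.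
- rewrite (_ : S `|` _ = \bigcup_(b in [set: bool]) if b then S else [set (Y, z0)]).
    by apply: bigcup_countable => // -[].
  by apply/seteqP; split=> [x [Sx|->]|x [[]]]; [exists true|exists false|left|right].
- move=> S0 S0n S0S v; have [YS0|nYS0] := boolP ((Y, z0) \in S0); last first.
    apply: Sind => // x xS0; have [//|xY] := S0S _ xS0.
    by rewrite xY in xS0; rewrite xS0 in nYS0.
  apply: contrapT => inf; apply: nodep; exists (S0 `\ (Y, z0))%fset, v; split.
    move=> x /=; rewrite !inE => /andP[/eqP xn xS0].
    by have [//|] := S0S _ xS0.
  have E n : \sum_(x <- S0) x.1 n = Y n + \sum_(x <- (S0 `\ (Y, z0))%fset) x.1 n.
    exact: (sumr_uniq_add (fun x : spair => x.1 n) YS0).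
  by under [X in infinite_set X]eq_set do rewrite -E.
split=> [p psi pf hpsi pN con|p psi pf hpsi pN pY con x [/con//|->//]|G sG GY Gz0 GS].
  by apply: (con (Y, z0)); right.
by split=> // x [/GS//|->].
Qed.

(** Fusion: the children of the root are treated one after the other, each on an
infinite subset of the set left by the previous one and above the systems already
constructed; the diagonal set is almost contained in all of these, so it serves
all children, and the sequence of their limits is treated by [add_sequence]. *)
Lemma front_limit M B (fr : is_front M B) f z st : good_system M st ->
  exists st' y, front_limit_spec fr f z st st' y.
Proof.
move: M B fr f z st; apply: front_ind => [M B fr B0 f z st gst|M B fr B0 IH f z st0 gst0].
  exists st, (f fset0); split; first by split.
  split=> // [p psi pf hpsi pN _|G sG Gf Gz GS].
    by rewrite flim0.
  by split=> //; exact: Gf.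
have /choice[T TP] (st : set nat * set spair) :
    exists r : nat * V * (set nat * set spair), good_system M st ->
    st.1 r.1.1 /\ exists Mn : M r.1.1,
    front_limit_spec (front_section fr B0 Mn) (fun s => f (r.1.1 |` s)%fset)
      (fun w => z (r.1.1 :: w)) (st.1 `&` [set m | (r.1.1 < m)%N], st.2) r.2 r.1.2.
  have [gst|ngst] := pselect (good_system M st); last by exists (0%N, 0, st).
  have [/infinite_setN0[n Nn] NM Sc Sind] := gst.
  have [|st' [y h]] := IH n (NM _ Nn) (fun s => f (n |` s)%fset)
    (fun w => z (n :: w)) (st.1 `&` [set m | (n < m)%N], st.2).
    have [Ninf _ _ _] := gst; split=> //=.
    - move=> fin; apply: Ninf; apply: (@sub_finite_set _ _
        ((st.1 `&` [set m | (n < m)%N]) `|` `I_n.+1)).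
        by move=> x Nx; have [/= xn|nx] := leqP x n; [right|left].
      by rewrite finite_setU; split=> //; exact: finite_II.
    - by move=> m [/NM Mm nm]; split.
    - apply: almost_indep_ext Sind _ _ => //; apply: sub_finite_set (finite_set0 _).
      by move=> m [[]].
  exists (n, y, st') => _ /=; split=> //; by exists (NM _ Nn).
pose sts k := iter k (fun st => (T st).2) st0.
pose h k := (T (sts k)).1.1; pose yy k := (T (sts k)).1.2.
have gsts k : good_system M (sts k).
  elim: k => //= k /TP[_ [Mn [[[inf sM c ind] _ _] _]]]; split=> //.
  by move=> x /sM[].
have step k := TP _ (gsts k).
have hN k : (sts k).1 (h k) by case: (step k).
have hM k : M (h k) by have [_ + _ _] := gsts k; apply.
have stepP k : front_limit_spec (front_section fr B0 (hM k)) (fun s => f (h k |` s)%fset)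
      (fun w => z (h k :: w)) ((sts k).1 `&` [set m | (h k < m)%N], (sts k).2)
      (sts k.+1) (yy k).
  by have [_ [Mn]] := step k; rewrite (Prop_irrelevance (hM k) Mn).
have NS k : (sts k.+1).1 `<=` (sts k).1 `&` [set m | (h k < m)%N].
  by have [[_ ? _] _] := stepP k.
have NSle k j : (k <= j)%N -> (sts j).1 `<=` (sts k).1.
  elim: j => [|j IHj]; first by rewrite leqn0 => /eqP->.
  rewrite leq_eqVlt => /orP[/eqP->//|/IHj]; apply: subset_trans.
  by move=> x /NS[].
have SSle k j : (k <= j)%N -> (sts k).2 `<=` (sts j).2.
  elim: j => [|j IHj]; first by rewrite leqn0 => /eqP->.
  rewrite leq_eqVlt => /orP[/eqP->//|/IHj]; move=> /subset_trans; apply.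
  by have [[_ _ ?] _] := stepP j.
have hS k : (h k < h k.+1)%N by have [] := NS k _ (hN k.+1).
have hlt : {homo h : i j / (i < j)%N} by apply: homo_ltn => // ? ? ?; apply: ltn_trans.
have hinj : injective h.
  move=> i j hij; case: (ltngtP i j) => // /hlt; by rewrite hij ltnn.
pose Nw := range h; pose Sw := \bigcup_k (sts k).2.
have Nwinf : infinite_set Nw.
  rewrite (eq_finite_set (inj_card_eq _)); first exact: infinite_nat.
  by move=> i j _ _ /hinj.
have NwN k : finite_set (Nw `\` (sts k).1).
  apply: (@sub_finite_set _ _ (h @` `I_k)); last first.
    by apply: finite_image; exact: finite_II.
  move=> _ [[j _ <-] nj]; exists j => //=; rewrite ltnNge; apply/negP => kj.
  by apply: nj; apply: NSle (hN j).
have pNw p k : free_ultrafilter p -> p Nw -> p (sts k).1.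
  move=> pf pN; apply: fuS (fuI pf pN (fu_cofinite pf (NwN k))) => // x [Nx nx].
  by apply: contrapT => ?; apply: nx.
have gw : good_system M (Nw, Sw).
  split=> //=.
  - by move=> _ [k _ <-].
  - by apply: bigcup_countable => // k _; have [] := gsts k.
  - move=> S0 S0n S0S v.
    have [k kP] : exists k, [set` S0] `<=` (sts k).2.
      suff H : forall s : seq spair, (forall x, x \in s -> Sw x) ->
          exists k, forall x, x \in s -> (sts k).2 x.
        by have [k kP] := H S0 S0S; exists k.
      elim=> [_|x s IHs sS]; first by exists 0%N.
      have [k kP] := IHs (fun y ys => sS y (mem_behead (s := x :: s) ys)).
      have [j _ jP] := sS x (mem_head _ _); exists (maxn k j) => y.
      rewrite inE => /orP[/eqP->|/kP]; first exact: (SSle _ _ (leq_maxr k j)).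
      exact: (SSle _ _ (leq_maxl k j)).
    have [_ _ _ ind] := gsts k.
    exact: (almost_indep_ext ind (@subset_refl _ _) (NwN k) S0n kP).
have /choice[Y YP] n : exists v, (forall k, h k = n -> yy k = v) /\
    ((forall k, h k <> n) -> v = 0).
  have [[k <-]|nk] := pselect (exists k, h k = n).
    by exists (yy k); split=> [j /hinj ->//|/(_ k)].
  by exists 0; split=> // k hk; case: nk; exists k.
have Yh k : Y (h k) = yy k by have [/(_ k) ->] := YP (h k).
have [N' [S' [y [[gN' N'N SwS'] [L1 L2 L3]]]]] := add_sequence Y (z [::]) gw.
have limh p psi : free_ultrafilter p -> bhom psi -> p Nw -> constraints p psi Sw ->
    forall k, flim p (front_section fr B0 (hM k))
      (fun s => psi (f (h k |` s)%fset) = psi (yy k)).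
  move=> pf hpsi pN con k; have [_ [l1 _ _]] := stepP k; apply: l1 => //.
    exact: pNw.
  by move=> x Sx; apply: con; exists k.+1.
exists (N', S'), y; split; first split=> //=.
- by move=> n /N'N[k _ <-]; exact: (NSle 0%N k) (hN k).
- by move=> x Sx; apply: SwS'; exists 0%N.
split=> [p psi pf hpsi /= pN con|p psi pf hpsi /= pN nl con|G [G0 GD] Gf Gz GS].
- have pNw' : p Nw by exact: (fuS pf N'N pN).
  rewrite (flimS _ _ B0); apply: fuS (fuI pf pNw' (L1 p psi pf hpsi pN con)) => //.
  move=> _ [[k _ <-] /=]; rewrite Yh => <-; exists (hM k).
  by apply: limh => // x Sx; apply: con; exact: SwS'.
- have pNw' : p Nw by exact: (fuS pf N'N pN).
  have conw : constraints p psi Sw.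
    move=> x [k _]; elim: k x => [|k IHk] x; first exact: con.
    have [_ [_ l2 _]] := stepP k; apply: (l2 p psi pf hpsi (pNw p k.+1 pf pNw')) => //.
    by move=> w fr'; apply: (nl (h k :: w) fr').
  apply: L2 => //; have := nl [::] fr; rewrite (flimS _ _ B0).
  move=> /(fuI pf pNw'); apply: fuS => // _ [[k _ <-] [Mn /= lk]].
  rewrite Yh; apply: (flim_uniq pf (limh p psi pf hpsi pNw' conw k)).
  by rewrite (Prop_irrelevance (hM k) Mn).
- have GSk k : spairs_in G (sts k).2 /\ forall j, (j < k)%N -> G (yy j).
    elim: k => [|k [IHk IHy]]; first by split.
    have [_ [_ _ l3]] := stepP k; have [||||Gy GSk] := l3 G => //.
    - by move=> s /(fsectionP fr); exact: Gf.
    - split=> // j; rewrite ltnS leq_eqVlt => /orP[/eqP->//|]; exact: IHy.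
  apply: L3 => //.
  - move=> n; have [[k <-]|nk] := pselect (exists k, h k = n).
      by rewrite Yh; have [_] := GSk k.+1; apply.
    by have [_ ->] := YP n => // k hk; apply: nk; exists k.
  - by move=> x [k _]; have [+ _] := GSk k; apply.
Qed.

End FrontLimit.

(** * Thinning to independent sequences *)

(** Well-founded recursion for a nondeterministic step [P] that only depends on
earlier values, and that can be taken whenever all earlier steps were correct. *)
Lemma wf_choice (A T : Type) (t0 : T) (R : A -> A -> Prop) (P : A -> (A -> T) -> T -> Prop) :
  well_founded R ->
  (forall a h h' t, (forall b, R b a -> h b = h' b) -> P a h t -> P a h' t) ->
  (forall a h, (forall b, R b a -> P b h (h b)) -> exists t, P a h t) ->
  exists h, forall a, P a h (h a).
Proof.
move=> wf loc ex.
have /choice[G GP] (ah : A * (A -> T)) : exists t, (exists t', P ah.1 ah.2 t') -> P ah.1 ah.2 t.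
  have [[t Pt]|nt] := pselect (exists t', P ah.1 ah.2 t'); first by exists t.
  by exists t0.
pose cut a (rec : forall b, R b a -> T) b :=
  if pselect (R b a) is left r then rec b r else t0.
pose F a (rec : forall b, R b a -> T) := G (a, cut a rec).
pose h := Fix wf (fun=> T) F.
have hE a : h a = G (a, cut a (fun b _ => h b)).
  rewrite /h Fix_eq// => x f g fg; rewrite /F; congr (G (x, _)).
  by apply/funext => b; rewrite /cut; case: pselect.
have cutE a b : R b a -> cut a (fun b _ => h b) b = h b.
  by rewrite /cut; case: pselect.
exists h; apply: (well_founded_ind wf) => a IH.
rewrite hE; apply: (loc _ (cut a (fun b _ => h b))) => [b /cutE//|].
apply: (GP (a, cut a (fun b _ => h b))) => /=; have [t Pt] := ex a h IH.
by exists t; apply: loc Pt => b /cutE.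
Qed.

Section Thinning.
Variable V : zmodType.
Hypothesis V2 : forall x : V, x + x = 0.

Definition pvec (e : nat -> option (spair V)) (l : nat) : nat -> V :=
  if e l is Some x then x.1 else fun=> 0.

Definition plim (e : nat -> option (spair V)) (l : nat) : V :=
  if e l is Some x then x.2 else 0.

(** Independence over the two-element field of the triangle l < a of an array of
vectors: at time [a], only finitely many of the sequences have been started. *)
Definition tri_indep (act : nat -> bool) (vec : nat -> nat -> V) :=
  forall T : {fset nat * nat}, (forall x, x \in T -> act x.2 /\ (x.2 < x.1)%N) ->
  \sum_(x <- T) vec x.1 x.2 = 0 -> T = fset0.

(** A term [nu a] is excluded only by the finitely many relations between the
first [a] sequences at that term and the finitely many vectors already chosen, and
by almost independence each relation excludes finitely many numbers. *)
Lemma thin_system M N S : good_system M (N, S) ->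
  exists (nu : nat -> nat) (e : nat -> option (spair V)),
  [/\ forall a, N (nu a), {homo nu : a b / (a < b)%N},
      forall x, S x <-> exists l, e l = Some x
    & tri_indep (fun l => e l) (fun a l => pvec e l (nu a))].
Proof.
move=> [/= Ninf NM Sc Sind].
have [e [eS einj]] := countable_enum Sc.
pose nn nu (x : nat * nat) := pvec e x.2 (nu x.1).
pose P a nu n := [/\ N n, forall b, (b < a)%N -> (nu b < n)%N &
  forall S0 T : {fset nat * nat}, S0 != fset0 ->
    (forall x, x \in S0 -> [/\ x.1 = a, e x.2 & (x.2 < a)%N]) ->
    (forall x, x \in T -> (x.1 < a)%N /\ (x.2 < x.1)%N) ->
    \sum_(x <- S0) pvec e x.2 n <> \sum_(x <- T) nn nu x].
have finS0 (S0 : {fset nat * nat}) a v : S0 != fset0 ->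
    (forall x, x \in S0 -> [/\ x.1 = a, e x.2 & (x.2 < a)%N]) ->
    finite_set [set n | N n /\ \sum_(x <- S0) pvec e x.2 n = v].
  move=> S0n S0P; pose g (x : nat * nat) := odflt ((fun=> 0) : nat -> V, 0 : V) (e x.2).
  have ginj : {in S0 &, injective g}.
    move=> x y xS yS; have [x1 ex _] := S0P _ xS; have [y1 ey _] := S0P _ yS.
    rewrite /g; case E: (e x.2) ex => [u|//] _; case E': (e y.2) ey => [u'|//] _ /= uu.
    move: x1 y1 E E' {xS yS}; case: x => ? l; case: y => ? l' /= -> -> E E'.
    by congr pair; apply: (einj _ _ u) => //; rewrite uu.
  have := Sind [fset g x | x in S0]%fset _ _ v.
  have -> : [set n | N n /\ \sum_(x <- [fset g x | x in S0]%fset) x.1 n = v] =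
            [set n | N n /\ \sum_(x <- S0) pvec e x.2 n = v].
    have E n : \sum_(x <- [fset g x | x in S0]%fset) x.1 n = \sum_(x <- S0) pvec e x.2 n.
      rewrite big_imfset//= big_seq [RHS]big_seq; apply: eq_bigr => x xS.
      by rewrite /g /pvec; case: (e x.2).
    by apply/seteqP; split=> n [Nn h]; split=> //; rewrite -h; [exact/esym/E|exact: E].
  apply.
    have /fset0Pn[x xS] := S0n; apply/fset0Pn; exists (g x); apply/imfsetP.
    by exists x.
  move=> y /imfsetP[x /= xS ->]; have [_ + _] := S0P _ xS; rewrite /g.
  by case E: (e x.2) => [u|//] _; apply/eS; exists x.2.
have [nu nuP] : exists nu, forall a, P a nu (nu a).
  apply: (wf_choice 0%N (R := fun b a : nat => (b < a)%N)).
  - by elim/ltn_ind => a IH; constructor.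
  - move=> a nu nu' n nunu' [Nn nun nT]; split=> //.
      by move=> b ba; rewrite -nunu'//; exact: nun.
    move=> S0 T S0n S0P TP; have := nT S0 T S0n S0P TP; congr (_ <> _).
    rewrite big_seq [RHS]big_seq; apply: eq_bigr => x /TP[xa _].
    by rewrite /nn nunu'.
  - move=> a nu _.
    pose D : {fset nat * nat} := [fset x in [seq (b, l) | b <- iota 0 a, l <- iota 0 a]]%fset.
    pose E : {fset nat * nat} := [fset x in [seq (a, l) | l <- iota 0 a]]%fset.
    pose bad := \bigcup_(S0 in [set S0 : {fset nat * nat} | S0 \in fpowerset E /\ S0 != fset0 /\
        forall x, x \in S0 -> [/\ x.1 = a, e x.2 & (x.2 < a)%N]])
      \bigcup_(T in [set T | T \in fpowerset D]) [set n | N n /\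
          \sum_(x <- S0) pvec e x.2 n = \sum_(x <- T) nn nu x].
    have badfin : finite_set bad.
      apply: bigcup_finite; first by apply: sub_finite_set (finite_fset (fpowerset E)) => x [].
      move=> S0 [_ [S0n S0P]]; apply: bigcup_finite; first exact: (finite_fset (fpowerset D)).
      by move=> T _; apply: (finS0 _ a).
    pose small := \bigcup_(b in `I_a) `I_(nu b).+1.
    have smallfin : finite_set small.
      by apply: bigcup_finite => [|b _]; exact: finite_II.
    have [n [Nn nbad]] : exists n, N n /\ ~ (bad `|` small) n.
      have : infinite_set (N `\` (bad `|` small)).
        by apply: infinite_setD => //; rewrite finite_setU.
      by move=> /infinite_setN0[n []]; exists n.
    exists n; split=> //.
      move=> b ba; rewrite ltnNge; apply/negP => nb; apply: nbad; right; exists b => //.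
    move=> S0 T S0n S0P TP En; apply: nbad; left; exists S0.
      split=> //; rewrite fpowersetE; apply/fsubsetP => x xS; have [x1 _ x2] := S0P _ xS.
      rewrite inE; apply/mapP; exists x.2; first by rewrite mem_iota.
      by case: x x1 {x2 xS} => ? ? /= ->.
    exists T => //=; rewrite fpowersetE; apply/fsubsetP => x /TP[xa x2].
    rewrite inE; apply/allpairsP; exists x; rewrite !mem_iota/= xa (ltn_trans x2 xa).
    by case: (x).
exists nu, e; split=> [a|b a ba|x|T TP T0].
- by case: (nuP a).
- by case: (nuP a) => _ + _; apply.
- exact: eS.
- apply/eqP; apply: contrapT => /negP Tn.
  have [x0 x0T x0max] : exists2 x, x \in T & forall y, y \in T -> (y.1 <= x.1)%N.
    have /fset0Pn[y yT] := Tn.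
    pose Q a := [exists x : T, (val x).1 == a].
    have Qex : exists a, Q a by exists y.1; apply/existsP; exists [` yT]%fset => /=.
    have Qb a : Q a -> (a <= \sum_(x <- T) x.1)%N.
      move=> /existsP[x /eqP <-]; rewrite (big_fsetD1 (val x)) ?(valP x)//=.
      exact: leq_addr.
    have [a /existsP[x /eqP xa] amax] := ex_maxnP Qex Qb.
    exists (val x); first exact: valP.
    by move=> z zT; rewrite xa; apply: amax; apply/existsP; exists [` zT]%fset => /=.
  (* the relation, solved for its part of largest first index *)
  case: (nuP x0.1) => _ _ /(_ [fset x in T | x.1 == x0.1]%fset [fset x in T | x.1 != x0.1]%fset).
  apply.
  + by apply/fset0Pn; exists x0; rewrite !inE eqxx andbT.
  + move=> x; rewrite !inE => /andP[xT /eqP x1]; have [ex xl] := TP _ xT.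
    by split=> //; rewrite -x1.
  + move=> x; rewrite !inE => /andP[xT x1]; have [ex xl] := TP _ xT.
    by split=> //; rewrite ltn_neqAle x1; exact: x0max.
  + move: T0; rewrite (big_fsetID _ (fun x : nat * nat => x.1 == x0.1))/= => /eqP.
    set A := (X in X + _); set B := (X in _ + X) => AB.
    have AB' : A = B by rewrite -[LHS]addr0 -(V2 B) addrA (eqP AB) add0r.
    rewrite -[RHS]AB' /A big_seq [RHS]big_seq; apply: eq_bigr => x.
    by rewrite !inE => /andP[_ /eqP ->].
Qed.

End Thinning.

(** * Linear algebra in Boolean groups *)

Section BooleanGroups.
Variable V : zmodType.
Hypothesis V2 : forall x : V, x + x = 0.

(** A subgroup that is maximal among those containing [F] and avoiding [v0] has
index two. *)
Lemma bhom_separation (F : set V) v0 : F 0 -> (forall x y, F x -> F y -> F (x + y)) ->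
  ~ F v0 -> exists psi : V -> bool, [/\ bhom psi, psi v0 & forall x, F x -> psi x = false].
Proof.
move=> F0 FD nF.
(* the empty set is admitted as the union of the empty chain *)
pose P : set (set V) := [set G | (forall x y, G x -> G y -> G (x + y)) /\ ~ G v0 /\
    F `<=` G \/ G = set0].
have [|G [PG Gmax]] := @Zorn_bigcup V P.
  move=> C CP Ctot; have [C0|C0] := pselect (forall X, C X -> X = set0).
    right; apply/seteqP; split=> // x [X CX]; by rewrite (C0 _ CX).
  left; have [X0 [CX0 X0n]] : exists X, C X /\ X <> set0.
    by apply: contrapT => h; apply: C0 => X CX; apply: contrapT => Xn; apply: h; exists X.
  split; last split.
  - move=> x y [X CX Xx] [Y CY Yy].
    have [Z [CZ Zx Zy]] : exists Z, [/\ C Z, Z x & Z y].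
      by have [XY|YX] := Ctot _ _ CX CY; [exists Y|exists X]; split=> //; [exact: XY|exact: YX].
    exists Z => //; case: (CP _ CZ) => [[ZD _]|Z0]; first exact: ZD.
    by rewrite Z0 in Zx.
  - move=> [X CX Xv]; case: (CP _ CX) => [[_ []]//|X0e].
    by rewrite X0e in Xv.
  - move=> x Fx; exists X0 => //; case: (CP _ CX0) => [[_ [_ FX]]|//]; exact: FX.
case: PG => [[GD [Gv FG]]|G0]; last first.
  exfalso; apply: (Gmax F); last by left; split=> //; split.
  by rewrite G0; split=> [x []|/(_ 0 F0) []].
have tot x : ~ G x -> G (v0 + x).
  move=> nGx; apply: contrapT => nGv.
  apply: (Gmax [set y | G y \/ G (y + x)]).
    split=> [y Gy|sub]; first by left.
    by apply/nGx/sub; right; rewrite /= V2; exact: FG.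
  left; split; last split.
  - move=> y y' [Gy|Gy] [Gy'|Gy'] /=.
    + by left; exact: GD.
    + by right; rewrite -addrA; exact: GD.
    + by right; rewrite addrAC; exact: GD.
    + left; rewrite -[y + y']addr0 -(V2 x) -addrA [y' + _]addrCA addrA.
      exact: GD.
  - by move=> [//|]; exact: nGv.
  - by move=> y /FG; left.
exists (fun x => ~~ `[< G x >]); split=> [x y||x /FG Gx].
- case: (asboolP (G x)) => Gx; case: (asboolP (G y)) => Gy /=.
  + by apply/negbTE; rewrite negbK; apply/asboolP/GD.
  + apply/asboolP => Gxy; apply: Gy.
    by rewrite -[y]add0r -(V2 x) -addrA; exact: GD.
  + apply/asboolP => Gxy; apply: Gx.
    by rewrite -[x]addr0 -(V2 y) addrA; exact: GD.
  + apply/negbTE; rewrite negbK; apply/asboolP.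
    have := GD _ _ (tot _ Gx) (tot _ Gy).
    by rewrite addrACA V2 add0r.
- exact/asboolP.
- by apply/negbTE; rewrite negbK; exact/asboolP.
Qed.

Definition symd (T : choiceType) (A B : {fset T}) := ((A `\` B) `|` (B `\` A))%fset.

Lemma in_symd (T : choiceType) (A B : {fset T}) x :
  (x \in symd A B) = (x \in A) (+) (x \in B).
Proof. by rewrite !inE; case: (x \in A); case: (x \in B). Qed.

Lemma sum_symd (T : choiceType) (A B : {fset T}) (F : T -> V) :
  \sum_(x <- symd A B) F x = \sum_(x <- A) F x + \sum_(x <- B) F x.
Proof.
have E (C D : {fset T}) : \sum_(x <- C) F x =
    \sum_(x <- (C `&` D)%fset) F x + \sum_(x <- (C `\` D)%fset) F x.
  rewrite (big_fsetID _ (fun x => x \in D))/=; congr (_ + _).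
    by apply: eq_fbigl => x; rewrite !inE.
  by apply: eq_fbigl => x; rewrite !inE andbC.
have -> : \sum_(x <- symd A B) F x =
    \sum_(x <- (A `\` B)%fset) F x + \sum_(x <- (B `\` A)%fset) F x.
  rewrite (big_fsetID _ (fun x => x \in A))/=; congr (_ + _); apply: eq_fbigl => x;
  by rewrite !inE; case: (x \in A); case: (x \in B).
by rewrite (E A B) (E B A) [(B `&` A)%fset]fsetIC addrACA V2 add0r.
Qed.

Fixpoint spn (s : seq V) (v : V) : Prop :=
  if s is x :: s' then spn s' v \/ spn s' (v + x) else v = 0.

Lemma spn0 s : spn s 0.
Proof. by elim: s => //= x s; left. Qed.

Lemma spnD s v w : spn s v -> spn s w -> spn s (v + w).
Proof.
elim: s v w => [v w /= -> ->|x s IH v w /=]; first by rewrite addr0.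
move=> [sv|sv] [sw|sw].
- by left; exact: IH.
- by right; rewrite -addrA; exact: IH.
- by right; rewrite addrAC; exact: IH.
- left; rewrite -[v + w]addr0 -(V2 x) addrACA; exact: IH.
Qed.

Lemma spn_mem s v : v \in s -> spn s v.
Proof.
elim: s => //= x s IH; rewrite inE => /orP[/eqP->|/IH]; last by left.
by right; rewrite V2; exact: spn0.
Qed.

Lemma spn_sum s (I : choiceType) (r : {fset I}) (F : I -> V) :
  (forall i, i \in r -> spn s (F i)) -> spn s (\sum_(i <- r) F i).
Proof.
move=> H; rewrite big_seq; elim/big_ind: _ => //; [exact: spn0|exact: spnD].
Qed.

(** Each vector of [s] costs one index: adding it to the span creates at most one
new relation up to the old ones, because two new relations add up to an old one, and
discarding a first index that occurs in this relation destroys it. *)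
Lemma delete_indices (vec : nat * nat -> V) (P : set (nat * nat)) (s : seq V) :
  (forall T : {fset nat * nat}, [set` T] `<=` P -> \sum_(x <- T) vec x = 0 -> T = fset0) ->
  exists2 R : {fset nat}, (#|` R| <= size s)%N &
    forall T : {fset nat * nat}, (forall x, x \in T -> P x /\ x.1 \notin R) ->
      spn s (\sum_(x <- T) vec x) -> T = fset0.
Proof.
move=> ind; elim: s => [|v s [R Rs RP]].
  exists fset0; first by rewrite cardfs0.
  by move=> T TP /= T0; apply: ind => // x /TP[].
have [H|] := pselect (forall T : {fset nat * nat}, (forall x, x \in T -> P x /\ x.1 \notin R) ->
      spn (v :: s) (\sum_(x <- T) vec x) -> T = fset0).
  by exists R => //=; exact: leqW.
move=> /existsNP[T0 /not_implyP[T0P /not_implyP[sT0 T0n]]].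
case: sT0 => [sT0|sT0]; first by case: T0n; exact: RP.
have /fset0Pn[t tT0] : T0 != fset0 by exact/eqP.
exists (t.1 |` R)%fset.
  by rewrite cardfsU1 /= -add1n; apply: leq_add => //; case: (_ \in _).
move=> T TP; have TP' x : x \in T -> P x /\ x.1 \notin R.
  by move=> /TP[Px]; rewrite !inE negb_or => /andP[].
move=> /= [sT|sT]; first exact: RP.
have : symd T T0 = fset0.
  apply: RP => [x|].
    rewrite in_symd; case: (boolP (x \in T)) => [/TP'//|_]; exact: T0P.
  rewrite sum_symd; have := spnD sT sT0; by rewrite addrACA V2 addr0.
move=> /fsetP/(_ t); rewrite in_symd tT0 inE addbT => /negbFE /TP[_].
by rewrite !inE eqxx.
Qed.

End BooleanGroups.

(** * Generic ultrafilters *)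

Notation bits := (nat -> bool).

(* Block m starts at block_start m and has m * codim m + 1 elements. The number
   codim m bounds the number of vectors to be avoided in block m: a fixed vector, m.+1
   times m limits, and m vectors for each element of an earlier block. *)
Fixpoint block_start (m : nat) : nat :=
  if m is m'.+1 then (block_start m' + (m' * (1 + m'.+1 * m' + block_start m' * m')).+1)%N else 0.
Definition codim m := (1 + m.+1 * m + block_start m * m)%N.

Lemma block_startS m : block_start m.+1 = (block_start m + (m * codim m).+1)%N. Proof. by []. Qed.

Lemma block_start_ge m : (m <= block_start m)%N.
Proof. by elim: m => // m IH; rewrite block_startS; lia. Qed.

Lemma block_start_mono : {homo block_start : m n / (m < n)%N}.
Proof. by apply: homo_ltn => [? ? ?|m]; [exact: ltn_trans|rewrite block_startS; lia]. Qed.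

Lemma block_start_mono_le : {homo block_start : m n / (m <= n)%N}.
Proof. by move=> m n; rewrite leq_eqVlt => /orP[/eqP->//|/block_start_mono/ltnW]. Qed.

Lemma block_ex a : exists m, (block_start m <= a < block_start m.+1)%N.
Proof.
have ex : exists m, (a < block_start m.+1)%N by exists a; exact: (block_start_ge a.+1).
have [m am mmin] := ex_minnP ex; exists m; rewrite am andbT.
case: m am mmin => // m _ mmin; rewrite leqNgt; apply/negP => /mmin; by rewrite ltnn.
Qed.

Definition block_of a : nat := sval (cid (block_ex a)).

Lemma block_ofP a : (block_start (block_of a) <= a < block_start (block_of a).+1)%N.
Proof. exact: svalP (cid (block_ex a)). Qed.

Lemma block_ofE a m : (block_start m <= a < block_start m.+1)%N -> block_of a = m.
Proof.
move=> /andP[h1 h2]; have /andP[h3 h4] := block_ofP a.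
apply/eqP; rewrite eqn_leq; apply/andP; split; rewrite leqNgt; apply/negP =>
    /block_start_mono_le; lia.
Qed.

(** The initial segments of a branch of the binary tree, as a set of numbers; two
branches have finitely many initial segments in common. *)
Definition branch (g : bits) : set nat := [set m | exists k, m = choice.pickle (mkseq g k)].

Lemma branch_disjoint g g' : g <> g' -> exists r, forall m, branch g m -> branch g' m -> (m < r)%N.
Proof.
move=> gg'; have [n nn] : exists n, g n <> g' n.
  by apply: contrapT => /forallNP h; apply: gg'; apply/funext => n; exact: contrapT.
exists (\sum_(k < n.+1) choice.pickle (mkseq g k)).+1%N => m [k ->] [k' E]; rewrite ltnS.
have {}E := pcan_inj choice.pickleK E.
have kk' : k = k' by have := congr1 size E; rewrite !size_mkseq.
have kn : (k < n.+1)%N.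
  rewrite ltnS leqNgt; apply/negP => nk; apply: nn.
  by have := congr1 (fun s => nth true s n) E; rewrite !nth_mkseq // -kk'.
by rewrite (bigD1 (Ordinal kn))//=; exact: leq_addr.
Qed.

Lemma branch_unbounded g r : exists2 m, branch g m & (r <= m)%N.
Proof.
pose h k := choice.pickle (mkseq g k).
have hinj : injective h.
  by move=> k k' /(pcan_inj choice.pickleK) /(congr1 size); rewrite !size_mkseq.
have hinf : infinite_set (range h).
  rewrite (eq_finite_set (inj_card_eq _)); first exact: infinite_nat.
  by move=> i j _ _ /hinj.
apply: contrapT => nr; apply: hinf; apply: (@sub_finite_set _ _ `I_r); last exact: finite_II.
move=> _ [k _ <-] /=; rewrite ltnNge; apply/negP => rk; apply: nr.
by exists (h k) => //; exists k.
Qed.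

(** The factor [r] makes this a filter, and the size of the blocks makes it
proper, since m * codim m exceeds r * codim m for the large blocks. *)
Definition gen_filter (g : bits) : set_system nat :=
  [set Y | exists r, forall m, branch g m -> (r <= m)%N ->
     exists2 R : {fset nat}, (#|` R| <= r * codim m)%N &
       forall a, block_of a = m -> a \notin R -> Y a].

Lemma gen_filter_filter g : Filter (gen_filter g).
Proof.
split.
- by exists 0%N => m _ _; exists fset0 => //; rewrite cardfs0.
- move=> A B [r rA] [r' rB]; exists (r + r')%N => m gm rm.
  have [R Rc RA] := rA m gm (leq_trans (leq_addr _ _) rm).
  have [R' Rc' RB] := rB m gm (leq_trans (leq_addl _ _) rm).
  exists (R `|` R')%fset.
    apply: leq_trans (_ : #|` R| + #|` R'| <= _)%N; first by rewrite cardfsU leq_subr.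
    by rewrite mulnDl leq_add.
  move=> a am; rewrite !inE negb_or => /andP[nR nR']; split; [exact: RA|exact: RB].
- move=> A B AB [r rA]; exists r => m gm rm; have [R Rc RA] := rA m gm rm.
  by exists R => // a am /RA h; apply: AB; exact: h.
Qed.

Lemma gen_filter_infinite g A : gen_filter g A -> infinite_set A.
Proof.
move=> [r rA] /finite_seqP[s sA].
have [m gm] := branch_unbounded g (r + 1 + \max_(x <- s) x).
move=> rm; have [|R Rc RA] := rA m gm; first by lia.
have [a [am aR]] : exists a, block_of a = m /\ a \notin R.
  apply: contrapT => /forallNP h.
  have : ([fset x in iota (block_start m) (m * codim m).+1] `<=` R)%fset.
    apply/fsubsetP => x; rewrite !inE mem_iota => xm; apply: contrapT => xR.
    apply: (h x); split; last exact/negP.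
    by apply: block_ofE; rewrite block_startS; lia.
  move=> /fsubset_leq_card; rewrite card_fseq undup_id ?iota_uniq// size_iota.
  have : (r * codim m <= m * codim m)%N by rewrite leq_mul2r; apply/orP; right; lia.
  by lia.
have : A a by exact: RA.
rewrite sA /= => as_.
have : (a <= \max_(x <- s) x)%N by rewrite (leq_bigmax_seq a).
have := block_start_ge m; have := block_ofP a; rewrite am; lia.
Qed.

Lemma gen_ultra_ex g : exists2 p, free_ultrafilter p & gen_filter g `<=` p.
Proof.
apply: free_ultrafilter_exists; [exact: gen_filter_filter|exact: gen_filter_infinite].
Qed.

Definition gen_ultra g : set_system nat := s2val (cid2 (gen_ultra_ex g)).

Lemma gen_ultra_free g : free_ultrafilter (gen_ultra g).
Proof. exact: (s2valP (cid2 (gen_ultra_ex g))). Qed.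

Lemma gen_ultra_sub g : gen_filter g `<=` gen_ultra g.
Proof. exact: (s2valP' (cid2 (gen_ultra_ex g))). Qed.

(** * Trivializing countably many systems *)

Section Core.
Variable V : zmodType.
Hypothesis V2 : forall x : V, x + x = 0.
Variables (gam : nat -> bits) (live : nat -> bool) (act : nat -> nat -> bool).
Variables (vec : nat -> nat -> nat -> V) (z : nat -> nat -> V) (v0 : V).
Hypothesis gam_inj : forall i j, live i -> live j -> gam i = gam j -> i = j.
Hypothesis act_live : forall i l, act i l -> live i.
Hypothesis vec_ind : forall i, tri_indep (act i) (vec i).
Hypothesis v0n : v0 <> 0.

(* The system in charge of block m: the first one whose branch contains m, or m.+1
   if there is none up to m. Each live system owns almost all blocks of its branch. *)
Let owner m := find (fun i => live i && `[< branch (gam i) m >]) (iota 0 m.+1).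

Let owner_eventually i : live i -> exists r, forall m, branch (gam i) m -> (r <= m)%N ->
  owner m = i.
Proof.
move=> li.
have [r rP] : exists r, forall j m, (j < i)%N -> live j -> branch (gam j) m ->
    branch (gam i) m -> (m < r)%N.
  suff H k : (k <= i)%N -> exists r, forall j m, (j < k)%N -> live j -> branch (gam j) m ->
    branch (gam i) m -> (m < r)%N by exact: H.
  elim: k => [_|k IH ki]; first by exists 0%N.
  have [r rP] := IH (ltnW ki).
  have [lk|lk] := boolP (live k); last first.
    exists r => j m; rewrite ltnS leq_eqVlt => /orP[/eqP-> |]; last exact: rP.
    by rewrite (negbTE lk).
  have [r' r'P] : exists r', forall m, branch (gam k) m -> branch (gam i) m -> (m < r')%N.
    by apply: branch_disjoint => /(gam_inj lk li) E; rewrite E ltnn in ki.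
  exists (r + r')%N => j m; rewrite ltnS leq_eqVlt => /orP[/eqP-> |].
    by move=> _ /r'P h /h; lia.
  by move=> /rP h lj /(h _ lj) {}h /h; lia.
exists (r + i)%N => m gm rm; rewrite /owner.
set q := fun i => _; have im : (i < m.+1)%N by lia.
have qi : q i by rewrite /q li/=; exact/asboolP.
have hq : has q (iota 0 m.+1) by apply/hasP; exists i; rewrite ?mem_iota.
have := nth_find 0%N hq; have := hq; rewrite has_find size_iota => fm.
rewrite nth_iota// add0n => /andP[lf /asboolP gf].
apply/eqP; rewrite eqn_leq; apply/andP; split; rewrite leqNgt; apply/negP => lt.
  by have := before_find 0%N lt; rewrite nth_iota// add0n qi.
by have := rP _ m lt lf gf gm; lia.
Qed.

Let w a l := vec (owner (block_of a)) a l.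

Let avoid m := v0 :: [seq z i l | i <- iota 0 m.+1, l <- iota 0 m] ++
                     [seq w a l | a <- iota 0 (block_start m), l <- iota 0 m].

Let size_avoid m : size (avoid m) = codim m.
Proof. by rewrite /avoid -cat1s !size_cat !size_allpairs size_map !size_iota /codim/=; lia. Qed.

Let valid m (x : nat * nat) :=
  [/\ block_of x.1 = m, (x.2 < m)%N, (owner m <= m)%N & act (owner m) x.2].

Let discard_ex m : exists2 R : {fset nat}, (#|` R| <= codim m)%N &
    forall T : {fset nat * nat}, (forall x, x \in T -> valid m x /\ x.1 \notin R) ->
      spn (avoid m) (\sum_(x <- T) w x.1 x.2) -> T = fset0.
Proof.
have [|R Rc RP] := @delete_indices V V2 (fun x => w x.1 x.2) (valid m) (avoid m).
  move=> T TP T0; apply: (@vec_ind (owner m)).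
    move=> x /TP[xm xl _ ?]; split=> //; have := block_ofP x.1; rewrite xm => /andP[h _].
    exact: leq_trans xl (leq_trans (block_start_ge m) h).
  rewrite -[RHS]T0 big_seq [RHS]big_seq; apply: eq_bigr => x /TP[xm _ _ _].
  by rewrite /w xm.
by exists R => //; rewrite -size_avoid.
Qed.

(** The relations identifying the vectors kept in each block with their limits do
not span [v0]: in a combination of them equal to [v0], the vectors of the last block
involved would be dependent modulo vectors that were avoided in this block. So a
homomorphism separates [v0] from these relations. *)
Lemma core : exists psi : V -> bool, [/\ bhom psi, psi v0 &
  forall i l, act i l -> gen_ultra (gam i) [set a | psi (vec i a l) = psi (z i l)]].
Proof.
have /choice[R RP] : forall m, exists R : {fset nat}, (#|` R| <= codim m)%N /\
    forall T : {fset nat * nat}, (forall x, x \in T -> valid m x /\ x.1 \notin R) ->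
      spn (avoid m) (\sum_(x <- T) w x.1 x.2) -> T = fset0.
  by move=> m; have [R] := discard_ex m; exists R.
pose kept (x : nat * nat) := valid (block_of x.1) x /\ x.1 \notin R (block_of x.1).
pose rel (x : nat * nat) := w x.1 x.2 + z (owner (block_of x.1)) x.2.
pose F : set V := [set v | exists T : {fset nat * nat}, (forall x, x \in T -> kept x) /\
   v = \sum_(x <- T) rel x].
have F0 : F 0 by exists fset0; rewrite big_seq_fset0.
have FD x y : F x -> F y -> F (x + y).
  move=> [T [TP ->]] [T' [TP' ->]]; exists (symd T T'); rewrite sum_symd//; split=> // t.
  rewrite in_symd; case: (boolP (t \in T)) => [/TP//|_]; exact: TP'.
have nF : ~ F v0.
  move=> [T [TP E]].
  have [T0|/eqP/fset0Pn[x0 x0T]] := pselect (T = fset0).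
    by move: E; rewrite T0 big_seq_fset0.
  pose Q m := [exists x : T, block_of (val x).1 == m].
  have Qex : exists m, Q m by exists (block_of x0.1); apply/existsP; exists [` x0T]%fset => /=.
  have Qb m : Q m -> (m <= \sum_(x <- T) block_of x.1)%N.
    move=> /existsP[x /eqP <-]; rewrite (big_fsetD1 (val x)) ?(valP x)//=.
    exact: leq_addr.
  have [m /existsP[x1 /eqP x1m] mmax] := ex_maxnP Qex Qb.
  have {}mmax x : x \in T -> (block_of x.1 <= m)%N.
    by move=> xT; apply: mmax; apply/existsP; exists [` xT]%fset => /=.
  have zavoid x : x \in T -> spn (avoid m) (z (owner (block_of x.1)) x.2).
    move=> xT; apply: spn_mem => //; rewrite /avoid inE mem_cat; apply/orP; right.
    apply/orP; left; apply/allpairsP; exists (owner (block_of x.1), x.2).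
    have [[_ xl om _] _] := TP _ xT; have xm := mmax _ xT.
    split=> //; last by rewrite mem_iota add0n /=; exact: leq_trans xl xm.
    by rewrite mem_iota add0n; exact: leq_trans om xm.
  have [_ /(_ [fset x in T | block_of x.1 == m]%fset)] := RP m.
  suff H : forall A : Prop, A -> (A -> [fset x in T | block_of x.1 == m]%fset = fset0) -> False.
    move=> h; apply: (H (spn (avoid m) (\sum_(x <- [fset x in T |
        block_of x.1 == m]%fset) w x.1 x.2))).
      have -> : \sum_(x <- [fset x in T | block_of x.1 == m]%fset) w x.1 x.2 =
        v0 + (\sum_(x <- [fset x in T | block_of x.1 == m]%fset) z (owner (block_of x.1)) x.2 +
          \sum_(x <- [fset x in T | block_of x.1 != m]%fset) rel x).
        have -> : v0 = \sum_(x <- [fset x in T | block_of x.1 == m]%fset) w x.1 x.2 +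
            \sum_(x <- [fset x in T | block_of x.1 == m]%fset) z (owner (block_of x.1)) x.2 +
            \sum_(x <- [fset x in T | block_of x.1 != m]%fset) rel x.
          by rewrite -big_split E [LHS](big_fsetID _ (fun x : nat * nat => block_of x.1 == m)).
        by rewrite -!addrA [X in _ + (_ + X)]addrCA [X in _ + X]addrA V2 add0r V2 addr0.
      apply: spnD => //; first by apply: spn_mem => //; exact: mem_head.
      apply: spnD => //.
        by apply: spn_sum => // x; rewrite !inE => /andP[xT _]; exact: zavoid.
      apply: spn_sum => // x; rewrite !inE => /andP[xT xm]; apply: spnD => //.
        apply: spn_mem => //; rewrite /avoid inE mem_cat; apply/orP; right.
        apply/orP; right; apply/allpairsP; exists x => /=.
        have [[_ xl om _] _] := TP _ xT; have xm' := mmax _ xT.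
        have lt : (block_of x.1 < m)%N by rewrite ltn_neqAle xm.
        rewrite !mem_iota !add0n /=; split=> //; last exact: ltn_trans xl lt.
        by have /andP[_ xb] := block_ofP x.1; exact: leq_trans xb (block_start_mono_le lt).
      exact: zavoid.
    move=> s; apply: h => // x; rewrite !inE => /andP[xT /eqP xm].
    by rewrite -xm; exact: TP.
  move=> A a /(_ a)/fsetP/(_ (val x1)); rewrite !inE x1m eqxx andbT.
  by rewrite (valP x1).
have [psi [hpsi psiv psiF]] := bhom_separation V2 F0 FD nF.
exists psi; split=> // i l il; apply: gen_ultra_sub.
have [r rP] := owner_eventually (act_live il).
exists (r + i + l + 1)%N => m gm rm; exists (R m).
  by have [h _] := RP m; apply: leq_trans h _; rewrite leq_pmull//; lia.
move=> a am aR /=.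
have om : owner m = i by apply: rP => //; lia.
have : F (rel (a, l)).
  exists [fset (a, l)]%fset; split; last by rewrite big_seq_fset1.
  move=> x; rewrite inE => /eqP->; rewrite /kept /valid /= am om; split=> //.
  by split=> //; lia.
move=> /psiF; rewrite /rel /w /= am om hpsi.
by case: (psi (vec i a l)); case: (psi (z i l)).
Qed.

End Core.

(** * The set of indices *)

Lemma strict_well_order (T : eqType) : exists lt : T -> T -> Prop,
  [/\ well_founded lt, forall a b c, lt a b -> lt b c -> lt a c,
      forall a, ~ lt a a & forall a b, [\/ lt a b, a = b | lt b a]].
Proof.
have [R wo] := well_ordering_principle T.
have min (A : set T) x : A x -> exists2 m, A m & forall y, A y -> R m y.
  move=> Ax; have [|m [[mA mlb] _]] := wo [pred y | `[< A y >]].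
    by exists x; apply/asboolP.
  exists m; first by move: mA => /asboolP.
  by move=> y Ay; apply: mlb; apply/asboolP.
have tot x y : R x y \/ R y x.
  have [m [->|->] h] := min [set z | z = x \/ z = y] x (or_introl erefl).
    by left; apply: h; right.
  by right; apply: h; left.
have anti x y : R x y -> R y x -> x = y.
  move=> xy yx; have [|m [_ muniq]] := wo [pred z | (z == x) || (z == y)].
    by exists x; rewrite inE eqxx.
  have rr z : R z z by case: (tot z z).
  rewrite -(muniq x) ?(muniq y)//; split; rewrite ?inE ?eqxx ?orbT// => z;
  by rewrite inE => /orP[]/eqP->.
have tr x y w : R x y -> R y w -> R x w.
  move=> xy yw; have [m mP h] := min [set z | [\/ z = x, z = y | z = w]] x (Or31 _ _ erefl).
  case: mP => E; subst m.
  - by apply: h; exact: Or33.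
  - have := h x (Or31 _ _ erefl) => yx; by rewrite (anti _ _ xy yx).
  - have := h y (Or32 _ _ erefl) => wy; by rewrite -(anti _ _ yw wy).
exists (fun a b => R a b /\ a <> b); split.
- move=> a; apply: contrapT => na.
  have [m mP h] := min [set z | ~ Acc (fun a b => R a b /\ a <> b) z] a na.
  apply: mP; constructor => y [ym yn]; apply: contrapT => /h my.
  by apply: yn; exact: anti.
- move=> a b c [ab nab] [bc nbc]; split; first exact: tr bc.
  by move=> ac; subst c; apply: nab; exact: anti.
- by move=> a [].
- move=> a b; have [->|nab] := pselect (a = b); first exact: Or32.
  have [h|h] := tot a b; first exact: Or31.
  by apply: Or33; split=> // E; exact: nab.
Qed.

(** The continuum injects into the finite structures over [A]. A number and a
sequence are enough to code any finite structure with labels in [A], even nested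
ones, so that this notion of largeness is insensitive to finite operations. *)
Definition big (T : eqType) (A : set T) :=
  exists g : bits -> nat * seq T, injective g /\ forall x y, y \in (g x).2 -> A y.

Lemma big_sub (T : eqType) (A B : set T) : A `<=` B -> big A -> big B.
Proof. by move=> AB [g [ginj gA]]; exists g; split=> // x y /gA/AB. Qed.

Lemma big_inj (T U : eqType) (A : set T) (B : set U) (h : nat * seq T -> nat * seq U) :
  (forall x x', (forall y, y \in x.2 -> A y) -> (forall y, y \in x'.2 -> A y) ->
     h x = h x' -> x = x') ->
  (forall x, (forall y, y \in x.2 -> A y) -> forall y, y \in (h x).2 -> B y) ->
  big A -> big B.
Proof.
move=> hinj hB [g [ginj gA]]; exists (h \o g); split=> [x x' /= E|x y /=].
  by apply: ginj; apply: hinj E => y; exact: gA.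
by apply: hB => z; exact: gA.
Qed.

Lemma big_add1 (T : eqType) (A : set T) j : big (A `|` [set j]) -> big A.
Proof.
apply: (big_inj (h := fun x => (choice.pickle (x.1, [seq y == j | y <- x.2]),
   [seq y <- x.2 | y != j]))).
  move=> [n s] [n' s'] _ _ /= [/(pcan_inj choice.pickleK) [-> E] E']; congr pair.
  elim: s s' E E' => [|y s IH] [|y' s'] //= [E1 E2].
  case: (eqVneq y j) E1 => [->|yj] /= /esym E1.
    by rewrite E1 /= => E'; rewrite (eqP E1) (IH s').
  by rewrite E1 /= => -[-> E']; rewrite (IH s').
move=> [n s] /= h y; rewrite mem_filter => /andP[/eqP yj /h[//|]].
by move=> E; case: yj.
Qed.

Lemma big_flatten (T : eqType) (A : set T) (U : eqType) (B : set U) (f : U -> nat * seq T) :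
  injective f -> (forall u, B u -> forall y, y \in (f u).2 -> A y) -> big B -> big A.
Proof.
move=> finj fA; apply: (big_inj (h := fun x =>
    (choice.pickle (x.1, [seq ((f u).1, size (f u).2) | u <- x.2]),
   flatten [seq (f u).2 | u <- x.2]))).
  move=> [n s] [n' s'] _ _ /= [/(pcan_inj choice.pickleK) [-> E] E']; congr pair.
  elim: s s' E E' => [|u s IH] [|u' s'] //= [E1 E2 E3] /eqP.
  rewrite eqseq_cat// => /andP[/eqP E4 /eqP E5]; rewrite (IH s')//; congr cons.
  by apply: finj; case: (f u) (f u') E1 E4 => ? ? [? ?] /= -> ->.
move=> [n s] /= h y /flatten_mapP[u us yu]; exact: fA (h u us) _ yu.
Qed.

Lemma bits_not_countable (f : bits -> nat) : injective f -> False.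
Proof.
move=> finj; pose d n := ~~ `[< exists2 x, f x = n & x n >].
have [h|h] := boolP (d (f d)).
  by move: (h); rewrite {1}/d => /asboolP; apply; exists d.
move: (h); rewrite {1}/d negbK => /asboolP[x /finj ->].
by rewrite (negbTE h).
Qed.

Definition code_seq (x : nat * seq bits) : bits := fun m =>
  match choice.unpickle m : option (nat + nat + nat * nat) with
  | Some (inl (inl i)) => i == x.1
  | Some (inl (inr i)) => i == size x.2
  | Some (inr (i, j)) => nth (fun=> false) x.2 i j
  | None => false
  end.

Lemma code_seq_inj : injective code_seq.
Proof.
move=> [n s] [n' s'] E.
have E' c := congr1 (fun f => f (choice.pickle (c : nat + nat + nat * nat))) E.
have En : n = n'.
  by have := E' (inl (inl n)); rewrite /code_seq choice.pickleK /= eqxx => /esym/eqP.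
have Es : size s = size s'.
  by have := E' (inl (inr (size s))); rewrite /code_seq choice.pickleK /= eqxx => /esym/eqP.
rewrite En; congr pair; apply: (@eq_from_nth _ (fun=> false)) => // i _.
apply/funext => j.
by have := E' (inr (i, j)); rewrite /code_seq choice.pickleK /=.
Qed.

(** A well-order of the continuum is cut at the first place where the finite
structures reach the continuum. If the segment had a largest element, this element
could be removed by [big_add1]; so the inequality may be weak in the third clause. *)
Lemma index_segment : exists (lt : bits -> bits -> Prop) (J : set bits),
  [/\ [/\ well_founded lt, forall a b c, lt a b -> lt b c -> lt a c,
      forall a, ~ lt a a & forall a b, [\/ lt a b, a = b | lt b a]],
      big J, forall j, J j -> ~ big [set x | lt x j \/ x = j]
    & forall j i, J j -> lt i j -> J i].
Proof.
have [lt [wf tr irr tot]] := strict_well_order bits.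
have [J [bJ nJ dJ]] : exists J : set bits,
    [/\ big J, forall j, J j -> ~ big [set x | lt x j] & forall j i, J j -> lt i j -> J i].
  have [[j bj]|nb] := pselect (exists j, big [set x | lt x j]); last first.
    exists setT; split=> // [|j _ bj]; last by apply: nb; exists j.
    by exists (fun x => (0%N, [:: x])); split=> // x y [].
  elim/(well_founded_ind wf): j bj => j IH bj.
  have [[i [ij bi]]|ni] := pselect (exists i, lt i j /\ big [set x | lt x i]).
    exact: (IH i).
  exists [set x | lt x j]; split=> //= [i ij bi|i k]; first by apply: ni; exists i.
  by move=> ij ki; exact: tr ij.
exists lt, J; split=> // j Jj bj; apply: (nJ j Jj).
have [[j' [Jj' jj']]|nj'] := pselect (exists j', J j' /\ lt j j').
  case: (nJ j' Jj'); apply: big_sub bj => x /= [xj|->//]; exact: tr jj'.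
by apply: (@big_add1 _ _ j); apply: big_sub bj => x /= [xj|xj]; [left|right].
Qed.

(** Elements are ordered by their largest label first, so those below [k] use
labels of a proper initial segment of [J]; finite structures over them are then
structures over that segment, by [big_flatten]. A countable unbounded set would write
the continuum as a countable union of sets that are not [big], which the diagonal
argument of Konig refutes. *)
Lemma index_type : exists (K : choiceType) (lt : K -> K -> Prop),
  [/\ well_founded lt, forall a b c, lt a b -> lt b c -> lt a c
    & forall a b, [\/ lt a b, a = b | lt b a]] /\
  [/\ forall k, ~ big [set j | lt j k],
      forall u : nat -> K, exists k, forall n, lt (u n) k,
      exists f : K -> bits, injective f
    & exists g : bits -> K, injective g].
Proof.
have [lt [J [[wf tr irr tot] [g [ginj gJ]] nJ dJ]]] := index_segment.
pose K : choiceType := {x : nat * seq bits | all (fun y => `[< J y >]) x.2}.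
have KJ (k : K) y : y \in (val k).2 -> J y.
  by move=> yk; have /allP/(_ _ yk)/asboolP := valP k.
have maxs (s : seq bits) : s <> [::] -> exists2 m, m \in s & forall y, y \in s -> lt y m \/ y = m.
  elim: s => // x s IH _; have [->|/IH[m ms h]] := pselect (s = [::]).
    by exists x; rewrite ?mem_head// => y; rewrite inE => /eqP->; right.
  have [xm|xm|mx] := tot x m.
  - exists m; first by rewrite inE ms orbT.
    by move=> y; rewrite inE => /orP[/eqP->|/h//]; left.
  - exists m; first by rewrite inE ms orbT.
    by move=> y; rewrite inE => /orP[/eqP->|/h//]; right.
  - exists x; first exact: mem_head.
    move=> y; rewrite inE => /orP[/eqP->|/h[ym|->]]; [by right| |by left].
    by left; exact: tr mx.
have [j0 Jj0] : exists j, J j.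
  apply: contrapT => /forallNP nj; apply: (@bits_not_countable (fun x => (g x).1)).
  move=> x x' E; apply: ginj; case: (g x) (g x') E (gJ x) (gJ x') => [n [|y s]] [n' [|y' s']] /=.
  - by move=> ->.
  - by move=> _ _ /(_ y' (mem_head _ _))/nj.
  - by move=> _ /(_ y (mem_head _ _))/nj.
  - by move=> _ /(_ y (mem_head _ _))/nj.
pose ub (k : K) j := J j /\ forall y, y \in (val k).2 -> lt y j \/ y = j.
have ubex k : exists j, ub k j.
  have [E|/maxs[m ms h]] := pselect ((val k).2 = [::]); first by exists j0; rewrite /ub E.
  by exists m; split=> //; exact: KJ ms.
have /choice[r rP] k : exists j, ub k j /\ forall i, ub k i -> lt j i \/ j = i.
  have [j uj] := ubex k; elim/(well_founded_ind wf): j uj => j IH uj.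
  have [[i [ij ui]]|ni] := pselect (exists i, lt i j /\ ub k i); first exact: (IH i).
  exists j; split=> // i ui; have [?|?|ij] := tot j i; [by left|by right|].
  by case: ni; exists i.
have [lK [wfK trK irrK totK]] := strict_well_order K.
pose ltK (a b : K) := lt (r a) (r b) \/ (r a = r b /\ lK a b).
exists K, ltK; split; split.
- suff H x : forall a, r a = x -> Acc ltK a by move=> a; exact: (H (r a)).
  elim/(well_founded_ind wf): x => x IH a; elim/(well_founded_ind wfK): a => a IHa ax.
  constructor=> b [ba|[ba lba]]; first by apply: (IH (r b)) => //; rewrite -ax.
  by apply: IHa => //; rewrite ba.
- move=> a b c [ab|[ab ab']] [bc|[bc bc']].
  + by left; exact: tr bc.
  + by left; rewrite -bc.
  + by left; rewrite ab.
  + by right; rewrite ab; split=> //; exact: trK bc'.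
- move=> a b; have [h|h|h] := tot (r a) (r b); [by apply: Or31; left| |by apply: Or33; left].
  have [h'|->|h'] := totK a b; [by apply: Or31; right|exact: Or32|by apply: Or33; right].
- move=> k bk; have [[Jr _] _] := rP k; apply: (nJ _ Jr).
  apply: (big_flatten (f := val) val_inj _ bk) => u /= ltu y yu.
  have [[_ /(_ _ yu) h] _] := rP u.
  case: ltu => [uk|[uk _]]; last by rewrite -uk.
  by case: h => [h|->]; left => //; exact: tr uk.
- move=> u; have [[j [Jj jP]]|nj] := pselect (exists j, J j /\ forall n, lt (r (u n)) j).
    have aj : all (fun y => `[< J y >]) (0%N, [:: j]).2 by rewrite /= andbT; exact/asboolP.
    exists (exist _ (0%N, [:: j]) aj : K) => n; left.
    have [[_ /(_ j)]] := rP (exist _ (0%N, [:: j]) aj : K).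
    rewrite /= mem_head => /(_ isT) h _; have := jP n.
    by case: h => [jr|<-//] h; exact: tr jr.
  exfalso.
  (* Konig: the n-th set misses some value of the n-th coordinate *)
  pose G n : set bits := [set x | forall y, y \in (g x).2 -> lt y (r (u n)) \/ y = r (u n)].
  have cov x : exists n, G n x.
    have [E|/maxs[m ms h]] := pselect ((g x).2 = [::]); first by exists 0%N => y; rewrite E.
    have Jm : J m by exact: gJ ms.
    have [n nP] : exists n, ~ lt (r (u n)) m.
      by apply: contrapT => /forallNP H; apply: nj; exists m; split=> // n; exact: contrapT.
    exists n => y /h ym.
    have mn : lt m (r (u n)) \/ m = r (u n).
      by have [//|E|?] := tot (r (u n)) m; [right|left].
    by case: ym mn => [ym|->] // [mn|<-]; left => //; exact: tr mn.
  pose pr (n : nat) (x : bits) : bits := fun m => x (choice.pickle (n, m)).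
  have miss n : exists c, forall x, G n x -> pr n x <> c.
    apply: contrapT => /forallNP nc.
    have /choice[h hP] c : exists x, G n x /\ pr n x = c.
      by have /existsNP[x /not_implyP[Gx /contrapT E]] := nc c; exists x.
    have [[Jr _] _] := rP (u n); apply: (nJ _ Jr).
    exists (fun c => g (h c)); split=> [c c' /ginj E|c]; last by have [] := hP c.
    by have [_ <-] := hP c; rewrite E; have [] := hP c'.
  have /choice[c cP] := miss.
  pose x : bits := fun m => if choice.unpickle m : option (nat * nat) is Some (n,
      m') then c n m' else false.
  have [n Gx] := cov x; apply: (cP n x Gx).
  by apply/funext => m; rewrite /pr /x choice.pickleK.
- by exists (fun k => code_seq (val k)) => k k' /code_seq_inj/val_inj.
- have gK x : all (fun y => `[< J y >]) (g x).2 by apply/allP => y /gJ Jy; exact/asboolP.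
  by exists (fun x => exist _ (g x) (gK x) : K) => x x' [/ginj].
Qed.

(** * The free Boolean group *)

(** The free Boolean group on [T]: a formal sum is the finite set of its terms. *)
Definition fbool (T : choiceType) := {fset T}.

HB.instance Definition _ (T : choiceType) := Choice.on (fbool T).

Section FreeBoolean.
Variable T : choiceType.

Lemma symdA : associative (@symd T).
Proof. by move=> A B C; apply/fsetP => x; rewrite !in_symd addbA. Qed.
Lemma symdC : commutative (@symd T).
Proof. by move=> A B; apply/fsetP => x; rewrite !in_symd addbC. Qed.
Lemma sym0d : left_id fset0 (@symd T).
Proof. by move=> A; apply/fsetP => x; rewrite in_symd inE. Qed.
Lemma symdd : left_inverse fset0 id (@symd T).
Proof. by move=> A; apply/fsetP => x; rewrite in_symd addbb inE. Qed.

HB.instance Definition _ := GRing.isZmodule.Build (fbool T) symdA symdC sym0d symdd.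

Lemma fbool2 (A : fbool T) : A + A = 0. Proof. exact: symdd. Qed.
Lemma in_fboolD (A B : fbool T) x : (x \in A + B) = (x \in A) (+) (x \in B).
Proof. exact: in_symd. Qed.

Definition fgen (x : T) : fbool T := [fset x]%fset.
End FreeBoolean.

Lemma sum_fboolD (T : choiceType) (W : zmodType) (W2 : forall x : W, x + x = 0)
    (A B : fbool T) (F : T -> W) :
  \sum_(x <- A + B) F x = \sum_(x <- A) F x + \sum_(x <- B) F x.
Proof. by rewrite -(sum_symd W2). Qed.

Lemma bool2 (b : bool) : b + b = 0. Proof. by case: b. Qed.

Definition fhom (T : choiceType) (c : T -> bool) (v : fbool T) : bool := \sum_(x <- v) c x.

Lemma fhom_bhom (T : choiceType) (c : T -> bool) : bhom (fhom c).
Proof. by move=> A B; rewrite /fhom (sum_fboolD bool2). Qed.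

Lemma fhom_gen (T : choiceType) (c : T -> bool) x : fhom c (fgen x) = c x.
Proof. by rewrite /fhom big_seq_fset1. Qed.

Section Swap.
Variables (T : choiceType) (s : T -> T).
Hypothesis sK : involutive s.

Definition fmapg (v : fbool T) : fbool T := [fset s x | x in (v : {fset T})]%fset.

Lemma in_fmapg v x : (x \in fmapg v) = (s x \in v).
Proof.
apply/imfsetP/idP => [[y /= yv ->]|sxv]; first by rewrite sK.
by exists (s x) => //; rewrite sK.
Qed.

Lemma fmapgD v w : fmapg (v + w) = fmapg v + fmapg w.
Proof. by apply/fsetP => x; rewrite in_fmapg !in_fboolD !in_fmapg. Qed.

Lemma fmapg0 : fmapg 0 = 0.
Proof. by apply/fsetP => x; rewrite in_fmapg !inE. Qed.

Lemma fmapg_inj : injective fmapg.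
Proof.
by move=> v w /fsetP E; apply/fsetP => x; have := E (s x); rewrite !in_fmapg sK.
Qed.

Lemma fmapg_sum (I : Type) (r : seq I) (F : I -> fbool T) :
  fmapg (\sum_(i <- r) F i) = \sum_(i <- r) fmapg (F i).
Proof. by rewrite (big_morph fmapg fmapgD fmapg0). Qed.
End Swap.

(** The form in which [core] is used: the systems of the indices in [D] make the
homomorphism compute the limits already in the group, and the two others enforce
what is wanted. *)
Lemma core_plus2 (V : zmodType) (V2 : forall x : V, x + x = 0) (K : Type)
    (D : set K) (gam : K -> bits) (act : K -> nat -> bool) (vec : K -> nat -> nat -> V)
    (z : K -> nat -> V) (gam0 gam1 : bits) (act0 act1 : nat -> bool)
    (vec0 vec1 : nat -> nat -> V) (z0 z1 : nat -> V) (v0 : V) :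
  countable D ->
  (forall a b, D a -> D b -> gam a = gam b -> a = b) ->
  gam0 <> gam1 -> (forall b, D b -> gam0 <> gam b) -> (forall b, D b -> gam1 <> gam b) ->
  (forall b, D b -> tri_indep (act b) (vec b)) -> tri_indep act0 vec0 -> tri_indep act1 vec1 ->
  v0 <> 0 ->
  exists psi : V -> bool, [/\ bhom psi, psi v0,
    forall b l, D b -> act b l -> gen_ultra (gam b) [set a | psi (vec b a l) = psi (z b l)],
    forall l, act0 l -> gen_ultra gam0 [set a | psi (vec0 a l) = psi (z0 l)]
    & forall l, act1 l -> gen_ultra gam1 [set a | psi (vec1 a l) = psi (z1 l)]].
Proof.
move=> /countable_enum[u [uD uinj]] gaminj g01 g0 g1 ind ind0 ind1 v0n.
pose pick (T : Type) (d : T) (x0 x1 : T) (x : K -> T) i :=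
  match i with 0%N => x0 | 1%N => x1 | i.+2 => if u i is Some b then x b else d end.
have DS i b : u i = Some b -> D b by move=> ?; apply/uD; exists i.
have [||||psi [hpsi psiv P]] :=
    @core V V2 (pick _ gam0 gam0 gam1 gam) (pick _ false true true (fun=> true))
    (pick _ (fun=> false) act0 act1 act) (pick _ (fun _ _ => 0) vec0 vec1 vec)
    (pick _ (fun=> 0) z0 z1 z) v0.
- move=> [|[|i]] [|[|j]] //=; try (case Ei: (u i) => [b|//]); try (case Ej: (u j) => [b'|//]).
  + by move=> _ _ E; case: (g0 _ (DS _ _ Ej) E).
  + by move=> _ _ /esym E; case: (g01 E).
  + by move=> _ _ E; case: (g1 _ (DS _ _ Ej) E).
  + by move=> _ _ /esym E; case: (g0 _ (DS _ _ Ei) E).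
  + by move=> _ _ /esym E; case: (g1 _ (DS _ _ Ei) E).
  + move=> _ _ /(gaminj _ _ (DS _ _ Ei) (DS _ _ Ej)) bb; rewrite -bb in Ej.
    by rewrite (uinj _ _ _ Ei Ej).
- by move=> [|[|i]] l //=; case: (u i).
- move=> [|[|i]] //=; case Ei: (u i) => [b|]; first exact: ind (DS _ _ Ei).
  move=> T TP _; apply/eqP; apply: contrapT => /negP/fset0Pn[x /TP[]//].
- by [].
exists psi; split=> //.
- move=> b l /uD[i ui] bl; have := P i.+2 l; rewrite /= ui; exact.
- by move=> l l0; exact: (P 0%N l).
- by move=> l l1; exact: (P 1%N l).
Qed.

(** * Listing the functions on fronts *)

Section Listing.
Variable K : choiceType.
Variable f : K -> bits.
Hypothesis finj : injective f.
Variable g : bits -> K.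
Hypothesis ginj : injective g.

(** A front [B] on [M] and a function on it, with values written as finite sums
of generators. *)
Definition item := {x : (set nat * set {fset nat}) * ({fset nat} -> fbool (nat + K)%type) |
  is_front x.1.1 x.1.2}.

Definition code_gen (x : nat + K) : bits :=
  match x with inl n => code_seq (n, [::]) | inr k => code_seq (0%N, [:: f k]) end.

Lemma code_gen_inj : injective code_gen.
Proof. by case=> [n|k] [n'|k'] /code_seq_inj [] // => [->|/finj ->]. Qed.

Definition code_fset (v : {fset nat + K}) : bits := code_seq (0%N, map code_gen v).

Lemma code_fset_inj : injective code_fset.
Proof.
by move=> v w /code_seq_inj [/(inj_map code_gen_inj)] E; apply/fsetP => x;
    have : (x \in enum_fset v) = (x \in enum_fset w) by rewrite E.
Qed.

Definition code_item (x : item) : bits := fun m =>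
  match choice.unpickle m : option (nat + {fset nat} + {fset nat} * nat) with
  | Some (inl (inl n)) => `[< (sval x).1.1 n >]
  | Some (inl (inr s)) => `[< (sval x).1.2 s >]
  | Some (inr (s, j)) => code_fset ((sval x).2 s) j
  | None => false
  end.

Lemma code_item_inj : injective code_item.
Proof.
case=> [[[M B] F] fr] [[[M' B'] F'] fr'] E; apply: eq_exist.
have E' c := congr1 (fun f => f (choice.pickle (c : nat + {fset nat} + {fset nat} * nat))) E.
congr (_, _, _).
- apply/seteqP; split=> n; have := E' (inl (inl n)); rewrite /code_item choice.pickleK /=;
  by [move=> + /asboolP => -> /asboolP|move=> + /asboolP => <- /asboolP].
- apply/seteqP; split=> n; have := E' (inl (inr n)); rewrite /code_item choice.pickleK /=;
  by [move=> + /asboolP => -> /asboolP|move=> + /asboolP => <- /asboolP].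
- apply/funext => s; apply: code_fset_inj; apply/funext => j.
  by have := E' (inr (s, j)); rewrite /code_item choice.pickleK.
Qed.

Lemma front_unit : is_front setT [set fset0].
Proof.
split=> [|s _ //|s t -> ->//|N Ninf _]; first exact: infinite_nat.
by exists fset0 => //; split=> [x|x y _] /=; rewrite inE.
Qed.

(** The indices [g (pair (code_item it) d)], for all [d], list [it]; as there are
continuum many, they are unbounded as soon as initial segments are small. *)
Lemma listing : exists L : K -> item, forall it, exists h : bits -> K,
  injective h /\ forall d, L (h d) = it.
Proof.
pose pair (a b : bits) := code_seq (0%N, [:: a; b]).
have pair_inj a b a' b' : pair a b = pair a' b' -> a = a' /\ b = b'.
  by move=> /code_seq_inj[-> ->].
pose it0 : item := exist _ (setT, [set fset0], fun=> fset0) front_unit.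
have /choice[L LP] (k : K) : exists it, forall it' d, k = g (pair (code_item it') d) -> it = it'.
  have [[it [d ->]]|n] := pselect (exists it d, k = g (pair (code_item it) d)).
    by exists it => it' d' /ginj/pair_inj[/code_item_inj].
  by exists it0 => it d E; case: n; exists it, d.
exists L => it; exists (fun d => g (pair (code_item it) d)); split.
  by move=> d d' /ginj/pair_inj[].
by move=> d; apply: LP.
Qed.

End Listing.

(** * The recursive construction *)

Section Construction.
Variables (K : choiceType) (lt : K -> K -> Prop).
Hypothesis lt_wf : well_founded lt.
Hypothesis lt_trans : forall a b c, lt a b -> lt b c -> lt a c.
Hypothesis lt_total : forall a b, [\/ lt a b, a = b | lt b a].
Hypothesis lt_small : forall k, ~ big [set j | lt j k].
Variable L : K -> item K.

Notation gens := (nat + option K * seq nat)%type.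
Notation V := (fbool gens).
Notation C := (bits -> bool).

Let iM k := (sval (L k)).1.1.
Let iB k := (sval (L k)).1.2.
Let iF k : {fset nat} -> fbool (nat + K)%type := (sval (L k)).2.
Let ifr k : is_front (iM k) (iB k) := svalP (L k).

Lemma lt_irr k : ~ lt k k.
Proof. by elim/(well_founded_ind lt_wf): k => k IH kk; exact: (IH k kk kk). Qed.

Definition formal_gen (x : K -> V) k (i : nat + K) : V :=
  match i with
  | inl n => fgen (inl n : gens)
  | inr b => if `[< lt b k >] then x b else 0
  end.

Definition formal_fun x k s : V := \sum_(i <- iF k s) formal_gen x k i.

Definition node_gen k (w : seq nat) : V := fgen (inr (Some k, w) : gens).

(** What [front_limit] and [thin_system] provide for an index. *)
Record formal_data := FormalData {
  fd_limit : V; fd_domain : set nat; fd_system : set (spair V); fd_enum : nat -> nat;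
  fd_code : nat -> option (spair V) }.

Definition formal_spec k (x : K -> V) (d : formal_data) :=
  front_limit_spec (ifr k) (formal_fun x k) (node_gen k) (iM k, set0) (fd_domain d,
      fd_system d) (fd_limit d) /\
  [/\ forall a, fd_domain d (fd_enum d a), {homo fd_enum d : a b / (a < b)%N},
      forall x, fd_system d x <-> exists l, fd_code d l = Some x
    & tri_indep (fun l => fd_code d l) (fun a l => pvec (fd_code d) l (fd_enum d a))].

Lemma formal_recursion : exists h : K -> formal_data, forall k, formal_spec k (fd_limit \o h) (h k).
Proof.
apply: (wf_choice (FormalData 0 set0 set0 id (fun=> None)) (P := fun k h =>
    formal_spec k (fd_limit \o h)) lt_wf).
  move=> k h h' t hh'; rewrite /formal_spec.
  suff -> : formal_fun (fd_limit \o h) k = formal_fun (fd_limit \o h') k by [].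
  apply/funext => s; apply: eq_bigr => -[n|b] _ //=.
  by case: asboolP => // /hh' ->.
move=> k h _.
have [|[N S] [y spec]] := front_limit (@fbool2 _) (ifr k) (formal_fun (fd_limit \o h) k)
    (node_gen k)
    (st := (iM k, set0)).
  split=> //=; first exact: front_infinite (ifr k).
  move=> S0 S0n S0S; have /fset0Pn[x /S0S] := S0n; by [].
have [[gst _ _] _] := spec.
have [nu [e thin]] := thin_system (@fbool2 _) gst.
by exists (FormalData y N S nu e); split.
Qed.

Variable h : K -> formal_data.
Hypothesis hP : forall k, formal_spec k (fd_limit \o h) (h k).

Let X k := fd_limit (h k).
Let f := formal_fun X.
Let nu k := fd_enum (h k).
Let e k := fd_code (h k).

Definition low_vec k (v : V) := forall g, g \in v ->
  match g with inl _ => True | inr (Some b, _) => lt b k | inr (None, _) => False end.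

Lemma low_vec_subgrp k : subgrp (low_vec k).
Proof.
split=> [g|v w lv lw g]; first by rewrite inE.
rewrite in_fboolD; case: (boolP (g \in v)) => [gv _|_]; first exact: lv.
exact: lw.
Qed.

Lemma subgrp_sum (W : zmodType) (G : W -> Prop) (I : choiceType) (r : {fset I}) (F : I -> W) :
  subgrp G -> (forall i, i \in r -> G (F i)) -> G (\sum_(i <- r) F i).
Proof. by move=> [G0 GD] GF; rewrite big_seq; elim/big_ind: _. Qed.

Lemma low_vec_X b k : lt b k -> low_vec k (X b).
Proof.
elim/(well_founded_ind lt_wf): b => b IH bk.
have [[_ [_ _ gp]] _] := hP b; have [] := gp (low_vec k) => //.
- exact: low_vec_subgrp.
- move=> s _; apply: subgrp_sum; first exact: low_vec_subgrp.
  move=> [n|b'] _ /=; first by move=> g; rewrite inE => /eqP ->.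
  case: asboolP => [b'b|_]; last by case: (low_vec_subgrp k).
  by apply: IH => //; exact: lt_trans bk.
- by move=> w g; rewrite inE => /eqP ->.
Qed.

Lemma low_vec_gen k i : low_vec k (formal_gen X k i).
Proof.
case: i => [n|b] /=; first by move=> g; rewrite inE => /eqP ->.
by case: asboolP => [/low_vec_X//|_]; case: (low_vec_subgrp k).
Qed.

Lemma low_vec_fun k s : low_vec k (f k s).
Proof. by apply: subgrp_sum => [|i _]; [exact: low_vec_subgrp|exact: low_vec_gen]. Qed.

Definition low k (S : fbool (nat + K)%type) := forall b, inr b \in S -> lt b k.

Lemma low0 k : low k 0. Proof. by move=> b; rewrite inE. Qed.
Lemma lowD k S T : low k S -> low k T -> low k (S + T).
Proof.
move=> lS lT b; rewrite in_fboolD; case: (boolP (inr b \in S)) => [bS _|_]; first exact: lS.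
exact: lT.
Qed.

Definition formal_ev k (S : fbool (nat + K)%type) : V := \sum_(i <- S) formal_gen X k i.

Lemma formal_evD k S T : formal_ev k (S + T) = formal_ev k S + formal_ev k T.
Proof. by rewrite /formal_ev (sum_fboolD (@fbool2 _)). Qed.

(** The limit is forced, whatever the ultrafilter: no formal limit of the index
itself occurs in it. *)
Definition triv k := exists2 S, low k S & X k = formal_ev k S.

Lemma X_decomp k : exists S (T : fbool (seq nat)), low k S /\
  X k = formal_ev k S + \sum_(w <- T) node_gen k w.
Proof.
have [[_ [_ _ gp]] _] := hP k.
pose G (v : V) := exists S (T : fbool (seq nat)), low k S /\
    v = formal_ev k S + \sum_(w <- T) node_gen k w.
have [] // := gp G.
- split; first by exists 0, 0; rewrite /formal_ev !big_seq_fset0 addr0; split => //; exact: low0.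
  move=> v v' [S [T [lS ->]]] [S' [T' [lS' ->]]]; exists (S + S'), (T + T').
  split; first exact: lowD.
  by rewrite formal_evD (sum_fboolD (@fbool2 _) T T') addrACA.
- move=> s _; exists [fset i in iF k s | if i is inr b then `[< lt b k >] else true]%fset, 0.
  split; first by move=> b; rewrite !inE => /andP[_ /asboolP].
  rewrite big_seq_fset0 addr0 /formal_ev /formal_fun [LHS](big_fsetID _ (fun i =>
    if i is inr b then `[< lt b k >] else true))/= [X in _ + X]big_seq [X in _ + X]big1 ?addr0//.
  by move=> [n|b]; rewrite !inE ?andbF// => /andP[_ /negbTE] /= ->.
- move=> w; exists 0, (fgen w); rewrite /formal_ev !big_seq_fset0 add0r big_seq_fset1.
  by split => //; exact: low0.
Qed.

(** The gens with first component [None] are spare copies of the formal limits of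
one index, for a second ultrafilter. *)
Definition swap k (g : gens) : gens :=
  match g with
  | inr (Some b, w) => if b == k then inr (None, w) else g
  | inr (None, w) => inr (Some k, w)
  | _ => g
  end.

Lemma swapK k : involutive (swap k).
Proof.
case=> [//|[[b|] w]] /=; last by rewrite eqxx.
by case: (eqVneq b k) => [->//|/negbTE /= ->].
Qed.

Lemma swap_low k v : low_vec k v -> fmapg (swap k) v = v.
Proof.
move=> lv.
have fix_ g : g \in v -> swap k g = g.
  move=> /lv; case: g => [//|[[b|//] w]] /= bk.
  by case: (eqVneq b k) => // E; case: (@lt_irr k); rewrite -{1}E.
apply/fsetP => g; rewrite (in_fmapg (swapK k)).
apply/idP/idP => [sg|gv]; last by rewrite fix_.
by have := fix_ _ sg; rewrite swapK => ->.
Qed.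

Lemma nontriv_swap k : ~ triv k -> X k + fmapg (swap k) (X k) <> 0.
Proof.
move=> nt; have [S [T [lS E]]] := X_decomp k.
rewrite E fmapgD; last exact: swapK.
rewrite (swap_low (v := formal_ev k S)); last first.
  by apply: subgrp_sum => [|i _]; [exact: low_vec_subgrp|exact: low_vec_gen].
rewrite addrACA fbool2 add0r fmapg_sum; last exact: swapK.
set Z := \sum_(w <- T) _; set Z' := \sum_(w <- T) _ => ZZ.
have inZ g : g \in Z -> exists w, g = inr (Some k, w).
  suff : subgrp (fun v : V => forall g, g \in v -> exists w, g = inr (Some k, w)).
    move=> sg; move: g; apply: (subgrp_sum sg) => w _ g.
    by rewrite inE => /eqP->; exists w.
  split=> [g'|v w lv lw g']; first by rewrite inE.
  by rewrite in_fboolD; case: (boolP (g' \in v)) => [/lv//|_ /lw].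
have ZE : Z' = fmapg (swap k) Z by rewrite fmapg_sum//; exact: swapK.
apply: nt; exists S => //; rewrite E -/Z.
suff -> : Z = 0 by rewrite addr0.
apply/fsetP => g; rewrite inE; apply/negP => gZ.
have [w gw] := inZ _ gZ; have := in_fboolD Z Z' g.
rewrite ZZ inE gZ ZE (in_fmapg (swapK k)) gw /= eqxx => /esym/negbFE.
by move=> /inZ[].
Qed.

(** * Evaluation at the points of the Cantor set *)

(** The generic ultrafilter of the branch [g], carried to the set on which the
system of [k] is independent. *)
Definition index_ultra k (g : bits) : set_system nat := [set A | gen_ultra g (nu k @^-1` A)].

Lemma nu_mono k : {homo nu k : a b / (a < b)%N}.
Proof. by have [_ []] := hP k. Qed.

Lemma nu_ge k a : (a <= nu k a)%N.
Proof. by elim: a => // a IH; apply: leq_ltn_trans IH _; exact: nu_mono. Qed.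

Lemma index_ultra_free k g : free_ultrafilter (index_ultra k g).
Proof.
exact: free_ultrafilter_push (gen_ultra_free g) (@nu_ge k).
Qed.

Lemma index_ultra_domain k g : index_ultra k g (fd_domain (h k)).
Proof.
apply: (fuS (gen_ultra_free g) _ (fuT (gen_ultra_free g))) => a _.
by have [_ [Nnu _ _ _]] := hP k; exact: Nnu.
Qed.

Lemma index_ultra_front k g : index_ultra k g (iM k).
Proof.
apply: (fuS (index_ultra_free k g) _ (index_ultra_domain k g)).
by have [[[_ NM _] _] _] := hP k.
Qed.

Definition respects k g (psi : V -> bool) := forall l, e k l ->
  gen_ultra g [set a | psi (pvec (e k) l (nu k a)) = psi (plim (e k) l)].

Lemma respects_lim k g psi : bhom psi -> respects k g psi ->
  flim (index_ultra k g) (ifr k) (fun s => psi (f k s) = psi (X k)).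
Proof.
move=> hpsi ck; have [[_ [l1 _ _]] [_ _ enum _]] := hP k.
apply: l1 => //; [exact: index_ultra_free|exact: index_ultra_domain|].
move=> x /= /enum[l el]; have := ck l; rewrite /e el => /(_ isT).
by rewrite /pvec /plim el.
Qed.

Definition actual_gen (c : K -> C) k (i : nat + K) (phi : bits) : bool :=
  match i with inl n => phi n | inr b => `[< lt b k >] && c b phi end.

Definition actual_ev c k (S : fbool (nat + K)%type) (phi : bits) : bool :=
    \sum_(i <- S) actual_gen c k i phi.

Definition actual_fun c k s : C := actual_ev c k (iF k s).

Definition is_actual_limit k g c (ck : C) :=
  forall phi, flim (index_ultra k g) (ifr k) (fun s => actual_fun c k s phi = ck phi).

Lemma formal_actual_ev psi c k S phi : bhom psi ->
  (forall n, phi n = psi (fgen (inl n : gens))) ->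
  (forall b, inr b \in S -> lt b k -> c b phi = psi (X b)) ->
      psi (formal_ev k S) = actual_ev c k S phi.
Proof.
move=> hpsi hphi hc; rewrite (bhom_sum hpsi) /actual_ev big_seq [RHS]big_seq.
apply: eq_bigr => -[n|b] iS /=; first by rewrite hphi.
by case: asboolP => [bk|_]; [rewrite hc|rewrite (bhom0 hpsi)].
Qed.

(** By induction on the index: a homomorphism that respects the systems of a set of
indices closed under dependence computes, on formal values, the points of these
indices at its own restriction to the coordinates. *)
Lemma eval_closed (D : set K) (gam : K -> bits) (c : K -> C) psi :
  (forall b s b', D b -> inr b' \in iF b s -> lt b' b -> D b') ->
  (forall b, D b -> is_actual_limit b (gam b) c (c b)) ->
  bhom psi -> (forall b, D b -> respects b (gam b) psi) ->
  forall b, D b -> c b (fun n => psi (fgen (inl n : gens))) = psi (X b).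
Proof.
move=> Dcl Dlim hpsi Dcon; elim/(well_founded_ind lt_wf) => b IH Db.
set phi := (fun n => _).
have lim := Dlim b Db phi.
have lim' := respects_lim hpsi (Dcon b Db).
apply: (flim_uniq (index_ultra_free b (gam b)) lim).
apply: flim_mono lim' => [|s _ <-]; first exact: index_ultra_free.
apply/esym; apply: formal_actual_ev => // b' b's b'b; apply: IH => //; exact: Dcl b's _.
Qed.

(** The indices on which [k] depends, itself included. Only countably many systems
can be trivialized at once, so this set has to be countable. *)
Inductive dep (k : K) : K -> Prop :=
| dep_refl : dep k k
| dep_step b s b' : inr b \in iF k s -> lt b k -> dep b b' -> dep k b'.

Lemma dep_closed k b s b' : dep k b -> inr b' \in iF b s -> lt b' b -> dep k b'.
Proof.
move=> kb; elim: kb => {k b} [k|k b t b'' bk lbk _ IH] b's lb'.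
  exact: (dep_step b's lb' (dep_refl _)).
exact: (dep_step bk lbk (IH b's lb')).
Qed.

Lemma countable_inr (S : fbool (nat + K)%type) : countable [set b | inr b \in S].
Proof.
have /countable_injP[rk rkinj] := @countable_fset _ (S : {fset nat + K}).
apply/countable_injP; exists (fun b => rk (inr b)) => b b' /set_mem /= bS /set_mem /= b'S E.
by have := rkinj (inr b) (inr b'); rewrite !inE => /(_ bS b'S E) [].
Qed.

Lemma dep_countable k : countable [set b | dep k b].
Proof.
elim/(well_founded_ind lt_wf): k => k IH.
pose U := \bigcup_(s in [set: {fset nat}])
  \bigcup_(b in [set b | inr b \in iF k s /\ lt b k]) [set b' | dep b b'].
have Uc : countable U.
  apply: bigcup_countable => // s _; apply: bigcup_countable => [|b [_ bk]]; last exact: IH.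
  apply: sub_countable (countable_inr (iF k s)).
  by apply: subset_card_le => b [].
apply: (@sub_countable _ _ _ (\bigcup_(t in [set: bool]) if t then U else [set k])).
  apply: subset_card_le => b [|b1 s b' b1s b1k b1b']; first by exists false.
  by exists true => //; exists s => //; exists b1.
by apply: bigcup_countable => // -[].
Qed.

Definition pred_dep k : set K := [set b' | exists b s, [/\ inr b \in iF k s, lt b k & dep b b']].

Lemma dep_le k b : dep k b -> b = k \/ lt b k.
Proof.
elim=> {k b} [k|k b s b' _ bk _ [->|b'b]]; [by left|by right|right].
exact: lt_trans bk.
Qed.

Lemma pred_dep_lt k b : pred_dep k b -> lt b k.
Proof. by move=> [b' [s [_ b'k /dep_le[->//|bb']]]]; exact: lt_trans b'k. Qed.

Lemma pred_dep_countable k : countable (pred_dep k).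
Proof.
apply: sub_countable (dep_countable k).
by apply: subset_card_le => b [b' [s [b's b'k bb']]]; exact: dep_step b's b'k bb'.
Qed.

Lemma pred_dep_closed k b s b' : pred_dep k b -> inr b' \in iF b s -> lt b' b -> pred_dep k b'.
Proof.
move=> [b1 [s1 [bs1 b1k d]]] b's b'b; exists b1, s1; split=> //; exact: dep_closed d b's b'b.
Qed.

Let vec k a l := pvec (e k) l (nu k a).

Lemma vec_indep k : tri_indep (fun l => e k l) (vec k).
Proof. by have [_ []] := hP k. Qed.

(** Two copies of the system of the index, one for each ultrafilter, are trivialized
together; the sum of the two formal limits is not zero, by [nontriv_swap], so the
homomorphism can be chosen not to kill it. *)
Lemma limits_distinct k (gam : K -> bits) (c : K -> C) g g' ck ck' :
  (forall b, lt b k -> is_actual_limit b (gam b) c (c b)) ->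
  (forall a b, lt a k -> lt b k -> gam a = gam b -> a = b) ->
  (forall b, lt b k -> g <> gam b) -> (forall b, lt b k -> g' <> gam b) ->
  is_actual_limit k g c ck -> is_actual_limit k g' c ck' -> ~ triv k -> g <> g' -> ck <> ck'.
Proof.
move=> lim ginj gn gn' lg lg' nt gg'.
have ltd b : pred_dep k b -> lt b k by exact: pred_dep_lt.
have ind' : tri_indep (fun l => e k l) (fun a l => fmapg (swap k) (vec k a l)).
  move=> T TP; rewrite -fmapg_sum; last exact: swapK.
  rewrite -[RHS](fmapg0 (swapK k)) => /(fmapg_inj (swapK k)); exact: vec_indep.
have [psi [hpsi psiv Pb P0 P1]] := core_plus2 (@fbool2 _) (act := fun b l => e b l) (vec := vec)
  (fun b l => plim (e b) l) (fun l => plim (e k) l) (fun l => fmapg (swap k) (plim (e k) l))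
  (pred_dep_countable k) (fun a b da db => ginj a b (ltd _ da) (ltd _ db)) gg'
  (fun b db => gn b (ltd _ db)) (fun b db => gn' b (ltd _ db))
  (fun b _ => @vec_indep b) (@vec_indep k) ind' (nontriv_swap nt).
pose phi n := psi (fgen (inl n : gens)).
have ev := eval_closed (@pred_dep_closed k) (fun b db => lim b (ltd _ db)) hpsi
  (fun b db l => Pb b l db).
have fcf s : psi (f k s) = actual_fun c k s phi.
  apply: formal_actual_ev => // b bs bk; apply: ev; exists b, s; split=> //; exact: dep_refl.
have E : ck phi = psi (X k).
  apply: (flim_uniq (index_ultra_free k g) (lg phi)).
  apply: flim_mono (respects_lim hpsi P0) => [|s _ <-]; first exact: index_ultra_free.
  by rewrite fcf.
have hpsi' : bhom (psi \o fmapg (swap k)).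
  by move=> v w /=; rewrite fmapgD ?hpsi//; exact: swapK.
have E' : ck' phi = psi (fmapg (swap k) (X k)).
  apply: (flim_uniq (index_ultra_free k g') (lg' phi)).
  apply: flim_mono (respects_lim hpsi' P1) => [|s _ /= <-]; first exact: index_ultra_free.
  by rewrite -fcf swap_low//; exact: low_vec_fun.
move=> cc; move: psiv; rewrite hpsi -E -E' cc; by case: (ck' phi).
Qed.

Lemma shift_at_comp (S T : Type) (a : S -> T) (F : {fset nat} -> S) w s :
  a (shift_at F w s) = shift_at (fun s => a (F s)) w s.
Proof. by elim: w F => //= n w IH F; rewrite IH. Qed.

Lemma front_at_p p (X0 : set nat * set {fset nat}) w : free_ultrafilter p -> p X0.1 ->
    p (front_at X0 w).1.
Proof.
move=> pf; elim: w X0 => //= n w IH X0 pX0; apply: IH; exact: tail_free.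
Qed.

(** For a prescribed point of the Cantor set genericity does not help, and the
systems of all indices have to be respected. The value at each formal limit is
defined as the limit of the actual function above its node, and the second clause of
[front_limit_spec] applies, by induction on the index. *)
Lemma eval_all (gam : K -> bits) (c : K -> C) (phi : bits) :
  (forall b, is_actual_limit b (gam b) c (c b)) ->
  exists psi : V -> bool, [/\ bhom psi, forall n, psi (fgen (inl n : gens)) = phi n
    & forall b, psi (X b) = c b phi].
Proof.
move=> lim.
have /choice[z zP] (bw : K * seq nat) : exists v, forall fr : is_front
    (front_at (iM bw.1, iB bw.1) bw.2).1 (front_at (iM bw.1, iB bw.1) bw.2).2,
    flim (index_ultra bw.1 (gam bw.1)) fr (fun s => shift_at (fun s =>
        actual_fun c bw.1 s phi) bw.2 s = v).
  case: bw => b w /=.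
  have [fr|nfr] := pselect (is_front (front_at (iM b, iB b) w).1 (front_at (iM b,
      iB b) w).2); last first.
    by exists false.
  have [|v vP] := flim_bool (index_ultra_free b (gam b)) fr (shift_at (fun s =>
      actual_fun c b s phi) w).
    by apply: front_at_p; [exact: index_ultra_free|exact: index_ultra_front].
  by exists v => fr'; rewrite (Prop_irrelevance fr' fr).
pose psi := fhom (fun g : gens => match g with
  inl n => phi n | inr (Some b, w) => z (b, w) | _ => false end).
have hpsi : bhom psi by exact: fhom_bhom.
exists psi; split=> // [n|]; first by rewrite /psi fhom_gen.
elim/(well_founded_ind lt_wf) => b IH.
have fcf s : psi (f b s) = actual_fun c b s phi.
  apply: formal_actual_ev => // [n|b' _ b'b]; first by rewrite /psi fhom_gen.
  by rewrite IH.
have [[_ [l1 l2 _]] _] := hP b.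
have lim1 : flim (index_ultra b (gam b)) (ifr b) (fun s => psi (f b s) = psi (X b)).
  apply: l1 => //; [exact: index_ultra_free|exact: index_ultra_domain|].
  apply: l2 => //; [exact: index_ultra_free|exact: index_ultra_domain|].
  move=> w fr; have := zP (b, w) fr; apply: flim_mono => [|s _]; first exact: index_ultra_free.
  rewrite (shift_at_comp psi) [psi (node_gen b w)]fhom_gen => <-; congr (shift_at _ w s).
  by apply/funext => s'; exact: fcf.
apply: (flim_uniq (index_ultra_free b (gam b)) lim1).
by apply: flim_mono (lim b phi) => [|s _]; [exact: index_ultra_free|rewrite fcf].
Qed.

(** * Choosing the ultrafilters *)

Definition even_coord n : C := fun phi => phi n.*2.
Definition odd_coord n : C := fun phi => phi n.*2.+1.
Definition islim (q : set_system nat) (u : nat -> C) (c : C) :=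
  forall phi, q [set n | u n phi = c phi].

(** Adding [c] to a group that contains [z1] and [z2] would create limits of both
sequences along one ultrafilter. *)
Definition bad (z1 z2 : C) (t1 t2 : bool) (c : C) := exists q, [/\ free_ultrafilter q,
  islim q even_coord (fun phi => z1 phi (+) (t1 && c phi)) &
  islim q odd_coord (fun phi => z2 phi (+) (t2 && c phi))].

(** One of the limits, or their sum, does not involve [c]. It determines the
ultrafilter, as the terms can be prescribed, and hence [c]. *)
Lemma bad_uniq z1 z2 t1 t2 c c' : t1 || t2 ->
  bad z1 z2 t1 t2 c -> bad z1 z2 t1 t2 c' -> c = c'.
Proof.
move=> t12 [q [qf q0 q1]] [q' [qf' q0' q1']].
(* the combination of the two sequences whose limit does not involve c *)
have comb r b : free_ultrafilter r ->
    islim r even_coord (fun phi => z1 phi (+) (t1 && b phi)) ->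
    islim r odd_coord (fun phi => z2 phi (+) (t2 && b phi)) ->
    forall phi, r [set n | (t2 && even_coord n phi) (+) (t1 && odd_coord n phi) = (t2 &&
        z1 phi) (+) (t1 && z2 phi)].
  move=> rf r0 r1 phi; apply: fuS (fuI rf (r0 phi) (r1 phi)) => // n [/= -> ->].
  by case: (t1); case: (t2); case: (z1 phi); case: (z2 phi); case: (b phi).
have qq' A : q A -> q' A.
  move=> qA; pose phi : bits := fun m => (odd m == t1) && `[< A m./2 >].
  have val n : (t2 && even_coord n phi) (+) (t1 && odd_coord n phi) = `[< A n >].
    rewrite /even_coord /odd_coord /phi /= odd_double doubleK uphalf_double.
    by move: t12; case: (t1); case: (t2); case: asboolP.
  have v1 : (t2 && z1 phi) (+) (t1 && z2 phi) = true.
    have [n [/= E An]] := fu_ex qf (fuI qf (comb q c qf q0 q1 phi) qA).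
    by rewrite -E val; exact/asboolP.
  apply: fuS (comb q' c' qf' q0' q1' phi) => // n /=; rewrite val v1.
  by move=> /asboolP.
apply/funext => phi.
have [n [[[/= E0 E1] E0'] E1']] := fu_ex qf' (fuI qf' (fuI qf' (fuI qf'
  (qq' _ (q0 phi)) (qq' _ (q1 phi))) (q0' phi)) (q1' phi)).
move: t12 E0' E1'; rewrite E0 E1.
by case: (t1); case: (t2); case: (z1 phi); case: (z2 phi); case: (c phi); case: (c' phi).
Qed.

Definition ultra_spec k (t : K -> bits * C) (d : bits * C) :=
  let c := fun b => (t b).2 in
  [/\ is_actual_limit k d.1 c d.2, forall b, lt b k -> d.1 <> (t b).1
    & ~ triv k -> forall S1 S2 t1 t2, low k S1 -> low k S2 -> t1 || t2 ->
        ~ bad (actual_ev c k S1) (actual_ev c k S2) t1 t2 d.2].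

Lemma actual_limit_ex k g c : exists ck, is_actual_limit k g c ck.
Proof.
have /choice[ck ckP] (phi : bits) : exists v, flim (index_ultra k g) (ifr k) (fun s =>
    actual_fun c k s phi = v).
  by apply: flim_bool; [exact: index_ultra_free|exact: index_ultra_front].
by exists ck.
Qed.

Definition split_gens (S : seq (nat + K)) : seq (option nat) * seq K :=
  ([seq if i is inl n then Some n else None | i <- S],
   pmap (fun i : nat + K => if i is inr b then Some b else None) S).

Lemma split_gens_inj : injective split_gens.
Proof.
elim=> [|[n|b] S IH] [|[n'|b'] S'] //.
- by move=> [E1 E2 E3]; rewrite E1 (IH S')// /split_gens E2 E3.
- by move=> [E1 E2 E3]; rewrite E2 (IH S')// /split_gens E1 E3.
Qed.

Lemma split_gens_mem S b : b \in (split_gens S).2 -> inr b \in S.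
Proof.
rewrite mem_pmap => /mapP[[n|b'] bS] //= [->]; exact: bS.
Qed.

(** A branch is unsuitable if it is in use, or if its limit is bad for two earlier
elements. By [bad_uniq] and [limits_distinct], the branch can be recovered from the
earlier index or from the two formal sums, so if all branches were unsuitable, then
the continuum would inject into the finite structures over the earlier indices. *)
Lemma ultrafilter_recursion : exists t : K -> bits * C, forall k, ultra_spec k t (t k).
Proof.
apply: (wf_choice ((fun=> false) : bits, (fun=> false) : C) (P := ultra_spec) lt_wf).
  move=> k t t' d tt' [lim used nbad].
  have cE S : actual_ev (fun b => (t b).2) k S = actual_ev (fun b => (t' b).2) k S.
    apply/funext => phi; apply: eq_bigr => -[n|b] _ //=.
    by case: asboolP => //= bk; rewrite tt'.
  split=> /=.
  - by move=> phi; apply: flim_mono (lim phi) => [|s _];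
      [exact: index_ultra_free|rewrite /actual_fun cE].
  - by move=> b bk; rewrite -tt'//; exact: used.
  - by move=> nt S1 S2 t1 t2; rewrite -!cE; exact: nbad.
move=> k t IH; pose c b := (t b).2.
have /choice[ck ckP] := fun g => actual_limit_ex k g c.
apply: contrapT => /forallNP nd; apply: (@lt_small k).
have lim b : lt b k -> is_actual_limit b (t b).1 c (c b) by move=> /IH[].
have ginj a b : lt a k -> lt b k -> (t a).1 = (t b).1 -> a = b.
  move=> ak bk E; case: (lt_total a b) => // ab.
    by have [_ /(_ _ ab) nE _] := IH b bk; case: nE.
  by have [_ /(_ _ ab) nE _] := IH a ak; case: nE.
have fail g : (exists2 b, lt b k & g = (t b).1) \/
    (forall b, lt b k -> g <> (t b).1) /\ ~ triv k /\
    exists x : (seq (nat + K) * seq (nat + K)) * (bool * bool),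
    [/\ forall b, inr b \in x.1.1 -> lt b k, forall b, inr b \in x.1.2 -> lt b k,
      x.2.1 || x.2.2 & bad (actual_ev c k [fset i in x.1.1]%fset) (actual_ev c k [fset i in
          x.1.2]%fset)
        x.2.1 x.2.2 (ck g)].
  have [[b bk ->]|nused] := pselect (exists2 b, lt b k & g = (t b).1); first by left; exists b.
  have used b : lt b k -> g <> (t b).1 by move=> bk E; apply: nused; exists b.
  right; split=> //; apply: contrapT => nb; apply: (nd (g, ck g)); split=>
      // nt S1 S2 t1 t2 l1 l2 t12.
  move=> badS; apply: nb; split=> //; exists ((enum_fset S1, enum_fset S2), (t1, t2)); split=> //=.
  have E (s : seq (nat + K)) (S : fbool (nat + K)%type) : enum_fset S = s ->
      [fset i in s]%fset = S :> fbool (nat + K)%type.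
    by move=> <-; apply/fsetP => i; rewrite !inE.
  by rewrite (E _ S1 erefl) (E _ S2 erefl).
have /choice[x xP] g : exists x : nat * seq K, (forall b, b \in x.2 -> lt b k) /\
    ((exists b, [/\ lt b k, g = (t b).1 & x = (0%N, [:: b])]) \/
    (forall b, lt b k -> g <> (t b).1) /\ ~ triv k /\
    exists (s1 s2 : seq (nat + K)) t1 t2, [/\ t1 || t2,
      bad (actual_ev c k [fset i in s1]%fset) (actual_ev c k [fset i in s2]%fset) t1 t2 (ck g) &
      x = ((choice.pickle (t1, t2, (split_gens s1).1, (split_gens s2).1,
          size (split_gens s1).2)).+1,
       (split_gens s1).2 ++ (split_gens s2).2)]).
  have [[b bk gb]|[used [nt [[[s1 s2] [t1 t2]] [/= l1 l2 t12 bd]]]]] := fail g.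
    exists (0%N, [:: b]); split; first by move=> b'; rewrite inE => /eqP->.
    by left; exists b.
  exists ((choice.pickle (t1, t2, (split_gens s1).1, (split_gens s2).1, size (split_gens s1).2)).+1,
       (split_gens s1).2 ++ (split_gens s2).2); split.
    by move=> b /=; rewrite mem_cat => /orP[] /split_gens_mem; [exact: l1|exact: l2].
  by right; split=> //; split=> //; exists s1, s2, t1, t2.
exists x; split=> [g g' E|g b]; last by have [+ _] := xP g; apply.
have [_ Pg] := xP g; have [_ Pg'] := xP g'; rewrite {}E in Pg.
case: Pg Pg' => [[b [bk -> ->]]|[used [nt [s1 [s2 [t1 [t2 [t12 bd ->]]]]]]]].
  by case=> [[b' [bk' -> [->]]]//|[_ [_ [? [? [? [? []]]]]]]].
case=> [[? []]//|[used' [_ [s1' [s2' [t1' [t2' [_ bd' [/(pcan_inj choice.pickleK) E E']]]]]]]]].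
case: E => E1 E2 E3 E4 E5; subst t1' t2'.
move/eqP: E'; rewrite eqseq_cat// => /andP[/eqP E6 /eqP E7].
have {E3 E6} ? : s1 = s1' by apply: split_gens_inj; rewrite /split_gens; congr (_, _).
have {E4 E7} ? : s2 = s2' by apply: split_gens_inj; rewrite /split_gens; congr (_, _).
subst s1' s2'; apply: contrapT => gg'.
apply: (limits_distinct lim ginj used used' (ckP g) (ckP g') nt gg').
exact: bad_uniq t12 bd bd'.
Qed.

(** * The group generated by the coordinates and the limits *)

Variable t : K -> bits * C.
Hypothesis tP : forall k, ultra_spec k t (t k).

Let gam b := (t b).1.
Let c b := (t b).2.

Definition gval (i : nat + K) (phi : bits) : bool :=
  match i with inl n => phi n | inr b => c b phi end.

Definition gev (S : fbool (nat + K)%type) (phi : bits) : bool := \sum_(i <- S) gval i phi.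

Definition gset : set C := [set x | exists S, x = gev S].

Lemma gevD S T phi : gev (S + T) phi = gev S phi (+) gev T phi.
Proof. by rewrite /gev (sum_fboolD bool2). Qed.

Lemma gev_gen i phi : gev (fgen i) phi = gval i phi.
Proof. by rewrite /gev big_seq_fset1. Qed.

Lemma gev_low k S : low k S -> gev S = actual_ev c k S.
Proof.
move=> lS; apply/funext => phi; rewrite /gev /actual_ev big_seq [RHS]big_seq.
apply: eq_bigr => -[n|b] bS //=; by case: asboolP => // -[]; exact: lS.
Qed.

Lemma actual_limit b : is_actual_limit b (gam b) c (c b). Proof. by case: (tP b). Qed.

Lemma gam_inj a b : gam a = gam b -> a = b.
Proof.
move=> E; case: (lt_total a b) => // ab.
  by have [_ /(_ _ ab) nE _] := tP b; case: nE.
by have [_ /(_ _ ab) nE _] := tP a; case: nE.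
Qed.

Lemma max_index (s : seq (nat + K)) : (forall b, inr b \notin s) \/
  exists2 b, inr b \in s & forall b', inr b' \in s -> b' = b \/ lt b' b.
Proof.
elim: s => [|[n|b] s IH]; first by left.
  case: IH => [ns|[b bs bmax]]; [left => b|right; exists b => [|b']];
  by rewrite inE/= ?negb_or ?ns//; exact: bmax.
right; case: IH => [ns|[b' b's b'max]].
  exists b => [|b']; first by rewrite mem_head.
  by rewrite inE (negbTE (ns _)) orbF => /eqP[->]; left.
have [bb'|bb'|b'b] := lt_total b b'.
- exists b' => [|b'']; first by rewrite inE b's orbT.
  by rewrite inE => /orP[/eqP[->]|/b'max//]; right.
- exists b => [|b'']; first by rewrite mem_head.
  by rewrite inE => /orP[/eqP[->]|/b'max]; [left|rewrite bb'].
- exists b => [|b'']; first by rewrite mem_head.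
  rewrite inE => /orP[/eqP[->]|/b'max[->|lb]]; [by left|by right|right].
  exact: lt_trans b'b.
Qed.

Lemma triv_gev k : triv k -> exists2 S, low k S & c k = gev S.
Proof.
move=> [S lS XS]; exists S => //; rewrite (gev_low lS); apply/funext => phi.
have [psi [hpsi psin psiX]] := eval_all phi actual_limit.
by rewrite -psiX XS; apply: formal_actual_ev => // b _ _; rewrite psiX.
Qed.

(** At the last index involved, common limits would have been excluded by the choice
of the ultrafilter, unless the point of this index is an earlier element, by which it
can then be replaced. *)
Lemma no_common_limit q S1 S2 : free_ultrafilter q ->
  ~ (islim q even_coord (gev S1) /\ islim q odd_coord (gev S2)).
Proof.
move=> qf.
have base T1 T2 : (forall b, inr b \notin T1) -> ~ (islim q even_coord (gev T1) /\
    islim q odd_coord (gev T2)).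
  move=> nT [/(_ (fun n => inl n \notin T1)) q0 _].
  pose N := \sum_(i <- T1) (if i is inl n then n else 0%N).
  have TN n : inl n \in T1 -> (n <= N)%N.
    by move=> nT1; rewrite /N (big_fsetD1 (inl n))//=; exact: leq_addr.
  have [n [/= + Nn]] := fu_ex qf (fuI qf q0 (fu_gt qf N)).
  have -> : gev T1 (fun n => inl n \notin T1) = false.
    rewrite /gev big_seq big1// => -[m|b] iT /=; first by rewrite iT.
    by have := nT b; rewrite iT.
  rewrite /even_coord => /negbFE /TN; rewrite leqNgt; apply/negP; rewrite negbK.
  by apply: leq_trans Nn _; rewrite -addnn leq_addr.
have claim k T1 T2 : (forall b, inr b \in T1 -> b = k \/ lt b k) ->
    (forall b, inr b \in T2 -> b = k \/ lt b k) ->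
    ~ (islim q even_coord (gev T1) /\ islim q odd_coord (gev T2)).
  elim/(well_founded_ind lt_wf): k T1 T2 => k IH T1 T2 T1k T2k.
  have lowcase R1 R2 : low k R1 -> low k R2 -> ~ (islim q even_coord (gev R1) /\
      islim q odd_coord (gev R2)).
    move=> l1 l2; have [nb|[b bR bmax]] := max_index (enum_fset R1 ++ enum_fset R2).
      by apply: base => b; have := nb b; rewrite mem_cat negb_or => /andP[].
    apply: (IH b).
    - by move: bR; rewrite mem_cat => /orP[/l1|/l2].
    - by move=> b' b'R; apply: bmax; rewrite mem_cat; apply/orP; left.
    - by move=> b' b'R; apply: bmax; rewrite mem_cat; apply/orP; right.
  pose cut (T : fbool (nat + K)%type) := if inr k \in T then T + fgen (inr k) else T.
  have lcut T : (forall b, inr b \in T -> b = k \/ lt b k) -> low k (cut T).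
    move=> Tk b; rewrite /cut; case: ifP => [kT|kT bT].
      rewrite in_fboolD inE; case: (boolP (inr b \in T)) => [/Tk[->|//]|bT].
        by rewrite eqxx.
      by move=> /eqP[E]; rewrite E kT in bT.
    by case: (Tk b bT) => // E; rewrite E kT in bT.
  have gcut T phi : gev T phi = gev (cut T) phi (+) ((inr k \in T) && c k phi).
    rewrite /cut; case: ifP => _; last by rewrite addbF.
    by rewrite gevD gev_gen /= -addbA addbb addbF.
  have [tk|ntk] := pselect (triv k).
    have [S0 lS0 cS0] := triv_gev tk.
    pose red T := cut T + (if inr k \in T then S0 else 0).
    have gred T : gev (red T) = gev T.
      apply/funext => phi; rewrite /red gevD (gcut T) cS0; congr (_ (+) _).
      by case: ifP => //= _; rewrite /gev big_seq_fset0.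
    have lred T : (forall b, inr b \in T -> b = k \/ lt b k) -> low k (red T).
      by move=> /lcut lT; apply: lowD => //; case: ifP => // _; exact: low0.
    by rewrite -(gred T1) -(gred T2); apply: lowcase; exact: lred.
  move=> [q0 q1]; have [t12|] := boolP ((inr k \in T1) || (inr k \in T2)); last first.
    rewrite negb_or => /andP[n1 n2]; apply: (lowcase T1 T2) => // b bT.
      by case: (T1k b bT) => // E; rewrite -E bT in n1.
    by case: (T2k b bT) => // E; rewrite -E bT in n2.
  have [_ _ /(_ ntk) nbad] := tP k.
  apply: (nbad _ _ _ _ (lcut _ T1k) (lcut _ T2k) t12); exists q.
  rewrite -(gev_low (lcut _ T1k)) -(gev_low (lcut _ T2k)); split=> // phi.
    by apply: fuS (q0 phi) => // n /= ->; rewrite gcut.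
  by apply: fuS (q1 phi) => // n /= ->; rewrite gcut.
have [nb|[b bR bmax]] := max_index (enum_fset S1 ++ enum_fset S2).
  by apply: base => b; have := nb b; rewrite mem_cat negb_or => /andP[].
apply: (claim b) => b' b'R; apply: bmax; rewrite mem_cat; apply/orP; by [left|right].
Qed.

Hypothesis lt_cofinal : forall u : nat -> K, exists k, forall n, lt (u n) k.
Hypothesis L_listing : forall it, exists l : bits -> K, injective l /\ forall d, L (l d) = it.

Lemma actual_limit_item k it : L k = it -> forall phi,
  flim (index_ultra k (gam k)) (svalP it) (fun s => actual_ev c k ((sval it).2 s) phi = c k phi).
Proof. by move=> <- phi; exact: actual_limit. Qed.

(** The formal sums for the values of the function involve countably many indices,
which are bounded, so the function is listed at some index above all of them. *)
Lemma gset_front_limit M B (fr : is_front M B) (F : {fset nat} -> C) :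
  (forall s, gset (F s)) -> exists p, [/\ free_ultrafilter p, p M &
    exists2 x, gset x & forall phi, flim p fr (fun s => F s phi = x phi)].
Proof.
move=> /choice[S FS]; have [l0 _] := L_listing (exist _ (setT, [set fset0], fun=>
    fset0) front_unit).
have /choice[u uP] n : exists b, forall s, choice.unpickle n = Some s ->
    forall b', inr b' \in S s -> b' = b \/ lt b' b.
  case: (choice.unpickle n) => [s|]; last by exists (l0 (fun=> false)).
  have [nb|[b bS bmax]] := max_index (enum_fset (S s)).
    by exists (l0 (fun=> false)) => _ [<-] b' b'S; have := nb b'; rewrite b'S.
  by exists b => _ [<-].
have [k0 k0P] := lt_cofinal u.
have lS s : low k0 (S s).
  move=> b bS; have [->|] := uP (choice.pickle s) s (choice.pickleK s) b bS; first exact: k0P.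
  by move=> h1; exact: lt_trans h1 (k0P _).
pose it : item K := exist _ ((M, B), S) fr.
have [l [linj lL]] := L_listing it.
have [d nd] : exists d, ~ lt (l d) k0.
  apply: contrapT => /forallNP h1; apply: (@lt_small k0).
  exists (fun d => (0%N, [:: l d])); split=> [d d' [/linj//]|d b].
  by rewrite inE => /eqP->; exact: contrapT (h1 d).
have {}lS s : low (l d) (S s).
  move=> b /lS bk; have [h1|<-//|h1] := lt_total k0 (l d); last by case: nd.
  exact: lt_trans bk h1.
exists (index_ultra (l d) (gam (l d))); split; first exact: index_ultra_free.
  by have := index_ultra_front (l d) (gam (l d)); rewrite /iM lL.
exists (c (l d)); first by exists (fgen (inr (l d))); apply/funext => phi; rewrite gev_gen.
move=> phi; have := actual_limit_item (lL d) phi.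
rewrite (Prop_irrelevance (svalP it) fr); apply: flim_mono => [|s _ <-];
    first exact: index_ultra_free.
by rewrite FS (gev_low (lS s)).
Qed.

Lemma bits_outside (A : set bits) : countable A -> exists g, ~ A g.
Proof.
move=> /countable_injP[rk rkinj]; apply: contrapT => /forallNP all.
apply: (@bits_not_countable rk) => g g' E; apply: rkinj => //; apply/mem_set; exact: contrapT.
Qed.

(** If infinitely many terms differ from the limit, then no element is a term for
infinitely many of these, so the formal sums for them have an independent
subsequence. Along two branches that are not in use, [core_plus2] sends it to 0 and
to 1, so its values at one point of the Cantor set do not converge. *)
Lemma gset_convergent (u : nat -> C) x : (forall n, gset (u n)) ->
  (forall phi, exists N, forall n, (N <= n)%N -> u n phi = x phi) ->
  finite_set [set n | u n <> x].
Proof.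
move=> /choice[S uS] conv; apply: contrapT => ninf.
pose w (i : nat + K) : V := match i with inl n => fgen (inl n : gens) | inr b => X b end.
pose W n := \sum_(i <- S n) w i.
have Wu n (psi : V -> bool) phi : bhom psi -> (forall m, phi m = psi (fgen (inl m : gens))) ->
    (forall b, inr b \in S n -> psi (X b) = c b phi) -> psi (W n) = u n phi.
  move=> hpsi hphi hX; rewrite uS /W (bhom_sum hpsi) /gev big_seq [RHS]big_seq.
  by apply: eq_bigr => -[m|b] iS /=; [rewrite hphi|rewrite hX].
have Winj m n : W m = W n -> u m = u n.
  move=> E; apply/funext => phi; have [psi [hpsi psin psiX]] := eval_all phi actual_limit.
  by rewrite -(Wu m psi)// -?(Wu n psi)// E.
have gs : good_system setT ([set n | u n <> x], [set (W, 0)]).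
  split=> //=.
  move=> S0 S0n S0S v; have S0E : S0 = [fset (W, 0)]%fset.
    have /fset0Pn[y yS0] := S0n; apply/fsetP => y'; rewrite inE.
    apply/idP/eqP => [/S0S//|->]; by rewrite -(S0S _ yS0).
  have [[m [mx mv]]|nm] := pselect (exists m, u m <> x /\ W m = v); last first.
    apply: sub_finite_set (finite_set0 _) => n [nx]; rewrite S0E big_seq_fset1 => nv.
    by apply: nm; exists n.
  have [phi phix] : exists phi, u m phi <> x phi.
    by apply: contrapT => /forallNP h1; apply: mx; apply/funext => phi; exact: contrapT.
  have [N NP] := conv phi; apply: (@sub_finite_set _ _ `I_N); last exact: finite_II.
  move=> n [nx]; rewrite S0E big_seq_fset1 /= -mv => /Winj E.
  by rewrite ltnNge; apply/negP => /NP; rewrite E.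
have [nu' [e' [_ numono enum ind]]] := thin_system (@fbool2 _) gs.
have [l0 el0] : exists l, e' l = Some (W, 0) by apply/enum.
pose D := \bigcup_n \bigcup_(b in [set b | inr b \in S n]) [set b' | dep b b'].
have Dc : countable D.
  apply: bigcup_countable => // n _; apply: bigcup_countable => [|b _]; last exact: dep_countable.
  exact: countable_inr.
have gDc : countable (gam @` D) by apply: sub_countable Dc; exact: card_image_le.
have [g0 g0D] := bits_outside gDc.
have [g1 g1D] : exists g1, ~ (gam @` D `|` [set g0]) g1.
  apply: bits_outside; rewrite (_ : _ `|` _ =
    \bigcup_(b in [set: bool]) if b then gam @` D else [set g0]).
    by apply: bigcup_countable => // -[].
  by apply/seteqP; split=> [y [Dy|->]|y [[]]]; [exists true|exists false|left|right].
pose v0 : V := fgen (inl 0%N : gens).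
have v0n : v0 <> 0 by move=> /fsetP/(_ (inl 0%N)); rewrite !inE eqxx.
have [psi [hpsi psiv PD P0 P1]] := core_plus2 (@fbool2 _) (gam := gam) (act := fun b l =>
    e b l) (vec := vec)
  (gam0 := g0) (gam1 := g1)
  (fun b l => plim (e b) l) (fun=> 0) (fun=> v0) Dc
  (fun a b _ _ => @gam_inj a b) (fun E => g1D (or_intror (esym E)))
  (fun b Db E => g0D (ex_intro2 _ _ b Db (esym E)))
  (fun b Db E => g1D (or_introl (ex_intro2 _ _ b Db (esym E))))
  (fun b _ => @vec_indep b) ind ind v0n.
pose phi n := psi (fgen (inl n : gens)).
have Dcl b s b' : D b -> inr b' \in iF b s -> lt b' b -> D b'.
  move=> [n _ [b1 b1S d1]] b's b'b; exists n => //; exists b1 => //; exact: dep_closed d1 b's b'b.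
have ev := eval_closed Dcl (fun b _ => actual_limit b) hpsi (fun b Db l => PD b l Db).
have uphi n : psi (W n) = u n phi.
  apply: Wu => // b bS; rewrite -ev//; exists n => //; exists b => //; exact: dep_refl.
have [N NP] := conv phi.
have nu_ge' a : (a <= nu' a)%N.
  by elim: a => // a IH; apply: leq_ltn_trans IH _; exact: numono.
have el : e' l0 by rewrite el0.
have val g z : gen_ultra g [set a | psi (pvec e' l0 (nu' a)) = z] -> x phi = z.
  move=> gz; have gf := gen_ultra_free g.
  have [a [/= az Na]] := fu_ex gf (fuI gf gz (fu_gt gf N)).
  move: az; rewrite /pvec el0 /= uphi NP//; exact: leq_trans (ltnW Na) (nu_ge' a).
have := val g0 _ (P0 l0 el); rewrite (bhom0 hpsi) => x0.
have := val g1 _ (P1 l0 el); by rewrite psiv x0.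
Qed.

Definition singletons : set {fset nat} := [set s | exists n, s = [fset n]%fset].

Lemma front_singletons : is_front setT singletons.
Proof.
split=> [|s _ //|s s' [n ->] [n' ->] [sub _]|N Ninf _]; first exact: infinite_nat.
  by have := sub n; rewrite /= !inE => /(_ (eqxx _))/eqP->.
have [n0 Nn0] := infinite_setN0 Ninf.
have ex : exists n, `[< N n >] by exists n0; exact/asboolP.
have [n /asboolP Nn nmin] := ex_minnP ex.
exists [fset n]%fset; first by exists n.
split=> [m|m m' Nm]; rewrite /= inE => /eqP->//.
by rewrite inE => mn; rewrite eqn_leq mn nmin//; exact/asboolP.
Qed.

(** The sequence of all coordinates is listed at continuum many indices. It can be
sent to 0 along the ultrafilter of one of them and to 1 along that of another. *)
Lemma gset_large : exists2 l : bits -> C, injective l & forall d, gset (l d).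
Proof.
pose F (s : {fset nat}) : fbool (nat + K)%type := fgen (inl (\sum_(i <- s) i)%N).
pose it : item K := exist _ ((setT, singletons), F) front_singletons.
have [l [linj lL]] := L_listing it.
exists (fun d => c (l d)); last first.
  by move=> d; exists (fgen (inr (l d))); apply/funext => phi; rewrite gev_gen.
have lim d phi : gen_ultra (gam (l d)) [set a | phi (nu (l d) a) = c (l d) phi].
  have := actual_limit_item (lL d) phi.
  have B0 : ~ (sval it).1.2 fset0 by move=> [n /fsetP/(_ n)]; rewrite !inE eqxx.
  rewrite (flimS _ _ B0); apply: (fuS (gen_ultra_free _)) => a /= [Mn].
  rewrite flim0; last first.
    exists [fset nu (l d) a]%fset; last by apply/fsetP => x; rewrite !inE; case: eqP.
    by split; [exists (nu (l d) a)|split=> [x /= ->|x y /=]; rewrite ?inE// => /eqP-> _].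
  by rewrite fsetU0 /= /actual_ev !big_seq_fset1 /= => <-.
move=> d d' E; apply: contrapT => dd'.
have ind b : tri_indep (fun l => l == 0%N) (fun a (_ : nat) => fgen (inl (nu b a) : gens)).
  move=> T TP T0; apply/eqP; apply: contrapT => /negP/fset0Pn[x xT].
  have := bhom_sum (fhom_bhom (fun g : gens => g == inl (nu b x.1))) (enum_fset T) xpredT
    (fun x => fgen (inl (nu b x.1) : gens)).
  rewrite T0 (bhom0 (fhom_bhom _)) (big_fsetD1 x)//= fhom_gen eqxx.
  rewrite big_seq big1 // => y; rewrite !inE => /andP[yx yT]; rewrite fhom_gen.
  apply/negbTE/negP => /eqP [E']; case/negP: yx; apply/eqP.
  have [/eqP x2 _] := TP _ xT; have [/eqP y2 _] := TP _ yT.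
  have numono b' : {homo nu b' : m n / (m < n)%N} by exact: nu_mono.
  have y1 : y.1 = x.1.
    by case: (ltngtP y.1 x.1) => // /(numono b); rewrite E' ltnn.
  by case: (x) (y) x2 y2 y1 => [? ?] [? ?] /= -> -> ->.
pose v0 : V := fgen (inl 0%N : gens).
have v0n : v0 <> 0 by move=> /fsetP/(_ (inl 0%N)); rewrite !inE eqxx.
have ldd : gam (l d) <> gam (l d') by move=> /gam_inj/linj.
have [psi [hpsi psiv _ P0 P1]] := core_plus2 (@fbool2 _) (gam := gam) (act := fun b l =>
    e b l) (vec := vec)
  (fun b l => plim (e b) l) (fun=> 0) (fun=> v0) (countable0 K)
  (fun a b _ _ => @gam_inj a b) ldd (fun b Db => False_ind _ Db) (fun b Db => False_ind _ Db)
  (fun b _ => @vec_indep b) (ind (l d)) (ind (l d')) v0n.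
pose phi n := psi (fgen (inl n : gens)).
have [a [/= a0 a0']] := fu_ex (gen_ultra_free _) (fuI (gen_ultra_free _) (P0 0%N isT) (lim d phi)).
have [b [/= b1 b1']] := fu_ex (gen_ultra_free _) (fuI (gen_ultra_free _) (P1 0%N isT) (lim d' phi)).
have : c (l d) phi = c (l d') phi by rewrite E.
by rewrite -a0' -b1' /phi a0 b1 (bhom0 hpsi) psiv.
Qed.

End Construction.

(** * Groups of functions on the Cantor set, with pointwise convergence *)

Record bsubgroup := BSubgroup {
  bset :> (bits -> bool) -> Prop;
  bset0 : bset (fun=> false);
  bsetD : forall x y, bset x -> bset y -> bset (fun phi => x phi (+) y phi) }.

Definition pgroup (Q : bsubgroup) := {x | Q x}.

HB.instance Definition _ (Q : bsubgroup) := gen_eqMixin (pgroup Q).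
HB.instance Definition _ (Q : bsubgroup) := gen_choiceMixin (pgroup Q).

Section PointwiseGroup.
Variable Q : bsubgroup.
Notation H := (pgroup Q).

Lemma pgroup_eq (x y : H) : (forall phi, sval x phi = sval y phi) -> x = y.
Proof. by case: x y => [x Qx] [y Qy] /= E; apply: eq_exist; apply/funext. Qed.

Definition pzero : H := exist _ _ (bset0 Q).
Definition padd (x y : H) : H := exist _ _ (bsetD (svalP x) (svalP y)).

Lemma paddA : associative padd.
Proof. by move=> x y z; apply: pgroup_eq => phi /=; rewrite addbA. Qed.
Lemma paddC : commutative padd.
Proof. by move=> x y; apply: pgroup_eq => phi /=; rewrite addbC. Qed.
Lemma padd0 : left_id pzero padd.
Proof. by move=> x; apply: pgroup_eq. Qed.
Lemma paddN : left_inverse pzero id padd.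
Proof. by move=> x; apply: pgroup_eq => phi /=; rewrite addbb. Qed.

HB.instance Definition _ := GRing.isZmodule.Build H paddA paddC padd0 paddN.

Definition pnbhs (x : H) : set_system H :=
  [set U | exists s : seq bits, forall y : H, (forall phi, phi \in s ->
      sval y phi = sval x phi) -> U y].

HB.instance Definition _ := hasNbhs.Build H pnbhs.

Lemma pnbhs_filter (x : H) : ProperFilter (nbhs x).
Proof.
apply: Build_ProperFilter_ex.
  by move=> A [s sA]; exists x; apply: sA.
split.
- by exists [::].
- move=> A B [s sA] [r rB]; exists (s ++ r) => y yE; split.
    by apply: sA => phi ps; apply: yE; rewrite mem_cat ps.
  by apply: rB => phi pr; apply: yE; rewrite mem_cat pr orbT.
- by move=> A B AB [s sA]; exists s => y /sA/AB.
Qed.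

Lemma pnbhs_singleton (x : H) (A : set H) : nbhs x A -> A x.
Proof. by move=> [s]; apply. Qed.

Lemma pnbhs_nbhs (x : H) (A : set H) : nbhs x A -> nbhs x (nbhs^~ A).
Proof.
move=> [s sA]; exists s => y yE; exists s => z zE; apply: sA => phi ps.
by rewrite zE// yE.
Qed.

HB.instance Definition _ :=
  Nbhs_isNbhsTopological.Build H pnbhs_filter pnbhs_singleton pnbhs_nbhs.

Lemma pnbhs_at (x : H) phi : nbhs x [set y : H | sval y phi = sval x phi].
Proof. by exists [:: phi] => y; apply; rewrite mem_head. Qed.

Lemma psub_continuous : continuous (fun x : H * H => x.1 - x.2).
Proof.
move=> [x y] U [s sU].
exists ([set x' : H | forall phi, phi \in s -> sval x' phi = sval x phi],
        [set y' : H | forall phi, phi \in s -> sval y' phi = sval y phi]).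
  by split; exists s.
move=> [x' y'] [/= xE yE]; apply: sU => phi ps.
by rewrite /= xE// yE.
Qed.

HB.instance Definition _ :=
  PreTopologicalNmodule_isTopologicalZmodule.Build H psub_continuous.

Lemma pgroup_hausdorff : hausdorff_space H.
Proof.
move=> x y xy; apply: pgroup_eq => phi.
by have [z [/= <- <-]] := xy _ _ (pnbhs_at x phi) (pnbhs_at y phi).
Qed.

Lemma pgroup_front_compact M B (fr : is_front M B) :
  (forall F : {fset nat} -> bits -> bool, (forall s, Q (F s)) ->
    exists p, [/\ free_ultrafilter p, p M &
      exists2 x, Q x & forall phi, flim p fr (fun s => F s phi = x phi)]) ->
  front_countably_compact H fr.
Proof.
move=> lim f; have [|p [pf pM [x Qx xlim]]] := lim (fun s => sval (f s)).
  by move=> s; exact: svalP.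
exists p; split=> //; exists (exist _ x Qx) => U [s sU].
suff : flim p fr (fun t => forall phi, phi \in s -> sval (f t) phi = x phi).
  by apply: flim_mono => // t _ /sU.
elim: s {sU} => [|phi s IH]; first exact: flimT.
apply: flim_mono (flimI pf (xlim phi) IH) => // t _ [h1 h2] psi.
by rewrite inE => /orP[/eqP->//|]; exact: h2.
Qed.

Lemma pgroup_no_convergent :
  (forall (u : nat -> bits -> bool) x, (forall n, Q (u n)) ->
    (forall phi, exists N, forall n, (N <= n)%N -> u n phi = x phi) ->
    finite_set [set n | u n <> x]) ->
  no_nontrivial_convergent_sequence H.
Proof.
move=> conv u x ux; exists x.
have fin : finite_set [set n | sval (u n) <> sval x].
  apply: (conv (fun n => sval (u n))) => [n|phi]; first exact: svalP.
  by have [N _ NP] := ux _ (pnbhs_at x phi); exists N => n Nn; apply: NP.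
have [r rP] : exists r, forall n, sval (u n) <> sval x -> (n < r)%N.
  have [s sE] : exists s : seq nat, [set n | sval (u n) <> sval x] = [set` s].
    by move/finite_seqP: fin.
  exists (\max_(i <- s) i).+1 => n nx; have : [set` s] n by rewrite -sE.
  by move=> /= ns; rewrite ltnS (leq_bigmax_seq n).
exists r => // n /= rn; apply: pgroup_eq => phi.
suff -> : sval (u n) = sval x by [].
by apply: contrapT => /rP; rewrite ltnNge rn.
Qed.

Hypothesis Qe0 : forall n, Q (even_coord n).
Hypothesis Qe1 : forall n, Q (odd_coord n).
Hypothesis no_limit : forall q x y, free_ultrafilter q -> Q x -> Q y ->
  ~ (islim q even_coord x /\ islim q odd_coord y).

Let h0 n : H := exist _ _ (Qe0 n).
Let h1 n : H := exist _ _ (Qe1 n).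

(** An accumulation point is a limit along some free ultrafilter, coordinate by
coordinate. *)
Lemma pgroup_square_not_countably_compact : ~ countably_compact (H * H)%type.
Proof.
move=> cc; have [[x y] xy] := cc (fun n => (h0 n, h1 n)).
pose F : set_system nat := [set A | exists2 U, nbhs (x, y) U & (fun n =>
    (h0 n, h1 n)) @^-1` U `<=` A].
have FF : Filter F.
  split.
  - by exists setT => //; exact: filterT.
  - move=> A B [U nU UA] [W nW WB]; exists (U `&` W); first exact: filterI.
    by move=> n [/UA An /WB Bn].
  - by move=> A B AB [U nU UA]; exists U => // n /UA/AB.
have [|q qf Fq] := @free_ultrafilter_exists F FF.
  by move=> A [U nU UA]; apply: sub_infinite_set (xy U nU).
apply: (no_limit qf (svalP x) (svalP y)); split=> phi.
- apply: Fq; exists [set z | sval z.1 phi = sval x phi] => //.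
  exists ([set z | sval z phi = sval x phi], setT); last by move=> z [].
  by split; [exact: pnbhs_at|exact: filterT].
- apply: Fq; exists [set z | sval z.2 phi = sval y phi] => //.
  exists (setT, [set z | sval z phi = sval y phi]); last by move=> z [].
  by split; [exact: filterT|exact: pnbhs_at].
Qed.

(** The function sends {n, m}, for n < m, to the sum of the even coordinate of n and
the odd coordinate of m. An intermediate limit, at a fixed n, puts the limit of the
odd coordinates in the group, and the final limit that of the even ones. *)
Lemma pgroup_not_two_cascade : ~ two_cascade_countably_compact H.
Proof.
move=> tc.
have fEx (s : {fset nat}) : exists v : H, forall n m, (n < m)%N -> s = [fset n; m]%fset ->
    v = h0 n + h1 m.
  have [[n [m [nm ->]]]|no] := pselect (exists n m, (n < m)%N /\ s = [fset n; m]%fset); last first.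
    by exists 0 => n m nm E; case: no; exists n, m.
  exists (h0 n + h1 m) => n' m' nm' /fsetP E.
  have := E n; have := E m; have := E n'; have := E m'.
  rewrite !inE !eqxx !orbT /=.
  move=> /orP m'E /orP n'E /esym/orP mE /esym/orP nE.
  have [-> ->//] : n = n' /\ m = m'.
    by case: nE mE n'E m'E => /eqP ? [] /eqP ? [] /eqP ? [] /eqP ?; lia.
have /choice[f fP] := fEx.
have [p [pf [A [y [x [pA ylim xlim]]]]]] := tc f.
have [n0 An0] := fu_ex pf pA.
have y1 n phi : A n -> p [set m | odd_coord m phi = (sval (y n) phi (+) even_coord n phi)].
  move=> An; have [_ /(_ _ (pnbhs_at (y n) phi))] := ylim n An.
  apply: fuS => // m [/= nm]; rewrite (fP _ n m)//= => <-.
  by rewrite addbC addbA addbb.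
have Qz : Q (fun phi => sval (y n0) phi (+) even_coord n0 phi) by apply: bsetD => //; exact: svalP.
pose z phi := sval (y n0) phi (+) even_coord n0 phi.
have yE n phi : A n -> sval (y n) phi = even_coord n phi (+) z phi.
  move=> An; have [m [/= m1 m2]] := fu_ex pf (fuI pf (y1 n phi An) (y1 n0 phi An0)).
  by rewrite /z -m2 m1 addbC -addbA addbb addbF.
apply: (no_limit pf (bsetD (svalP x) Qz) Qz); split=> phi; last exact: y1.
have [_ /(_ _ (pnbhs_at x phi))] := xlim; apply: fuS => // n [An /=].
by rewrite yE// -/(z phi) => <-; rewrite -addbA addbb addbF.
Qed.

End PointwiseGroup.

(** * The theorem *)

Lemma inj_card_leT (T U : Type) (f : T -> U) : injective f -> ([set: T] #<= [set: U])%card.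
Proof.
move=> finj; have : (f @` [set: T] #= [set: T])%card by apply: inj_card_eq => x y _ _ /finj.
by rewrite card_eq_le => /andP[_ h]; apply: card_le_trans h (card_leT _).
Qed.

(* A Boolean group is abelian, hence written additively. *)
Theorem theorem6p23 :
  exists H : topologicalZmodType,
    (forall x : H, x + x = 0) /\
    ([set: H] #= [set: nat -> bool])%card /\
    hausdorff_space H /\
    no_nontrivial_convergent_sequence H /\
    (forall (M : set nat) (B : set {fset nat}) (hB : is_barrier M B),
        front_countably_compact H (proj1 hB)) /\
    ~ countably_compact (H * H)%type /\
    ~ two_cascade_countably_compact H.
Proof.
have [K [lt [[wf tr tot] [small cof [fK fKinj] [g ginj]]]]] := index_type.
have [L LP] := listing fKinj ginj.
have [h hP] := formal_recursion wf L.
have [t tP] := ultrafilter_recursion wf tr tot small hP.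
pose Q0 := gset t.
have Q00 : Q0 (fun=> false).
  by exists 0; apply/funext => phi; rewrite /gev big_seq_fset0.
have Q0D x y : Q0 x -> Q0 y -> Q0 (fun phi => x phi (+) y phi).
  by move=> [S ->] [S' ->]; exists (S + S'); apply/funext => phi; rewrite gevD.
pose Q := BSubgroup Q00 Q0D.
have Qe n : Q0 (fun phi => phi n).
  by exists (fgen (inl n)); apply/funext => phi; rewrite gev_gen.
exists (pgroup Q).
have nolim q x y : free_ultrafilter q -> Q x -> Q y -> ~ (islim q even_coord x /\
    islim q odd_coord y).
  move=> qf [S ->] [S' ->]; exact: (no_common_limit wf tr tot hP tP qf).
split; [|split; [|split; [|split; [|split; [|split]]]]].
- by move=> x; apply: pgroup_eq => phi /=; rewrite addbb.
- rewrite card_eq_le; apply/andP; split.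
    have /choice[S SP] (x : pgroup Q) : exists S : {fset nat + K}, sval x = gev t S.
      by case: x => x /= [S ->]; exists S.
    apply: (@inj_card_leT _ _ (fun x => code_fset fK (S x))) => x y.
    move=> /(code_fset_inj fKinj) E; apply: pgroup_eq => phi; by rewrite !SP E.
  have [l linj lQ] := gset_large tot hP tP LP.
  apply: (@inj_card_leT _ _ (fun d => exist _ (l d) (lQ d) : pgroup Q)) => d d' [].
  exact: linj.
- exact: pgroup_hausdorff.
- apply: pgroup_no_convergent => u x Qu conv.
  exact: (gset_convergent wf tot hP tP Qu conv).
- move=> M B hB; apply: pgroup_front_compact => F QF.
  exact: (gset_front_limit tr tot small hP tP cof LP (proj1 hB) QF).
- exact: (@pgroup_square_not_countably_compact Q (fun n => Qe _) (fun n => Qe _) nolim).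
- exact: (@pgroup_not_two_cascade Q (fun n => Qe _) (fun n => Qe _) nolim).
Qed.
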